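(* Let $p$ be a prime, $h\geq 2$, $g\in \mathbb{S}_h$, and let $t_i=t_i(g)\in R$ be the associated elements. For $0\leq k <h-1$, $$t_k = t_k^{p^h}+u_{h-1} t_{k+1}^{p^{h-1}}-u_{h-1}^{p^{k+1}}t_{k+1}t_0^{p^{k+1}(p^{h-1}-1)} \mod I_{h-1}.$$
   Context: Let $\mathbb{W}=W(\mathbb{F}_{p^h})$ be the Witt vectors, $R=\mathbb{W}[[u_1,\dots,u_{h-1}]]$ with maximal ideal $(p,u_1,\dots,u_{h-1})$, and $I_{h-1}=(p,u_1,\dots,u_{h-2})$ (so $I_1=(p)$ when $h=2$). Let $\mathbb{H}$ be the Honda formal group law of height $h$: the unique $p$-typical formal group law over $\mathbb{F}_p$ with $p$-series $[p]_{\mathbb{H}}(x)=x^{p^h}$, regarded over $\mathbb{F}_{p^h}$. Universal deformation: let $V=\mathbb{Z}_{(p)}[v_1,v_2,\dots]$ be the ring representing $p$-typical formal group laws over $\mathbb{Z}_{(p)}$-algebras, with universal $p$-typical formal group law $G$ of logarithm $\sum_{i\ge0}l_ix^{p^i}$, $l_0=1$, where the $v_i$ are the Araki generators: $v_0=p$ and $p\,l_n=\sum_{0\le i\le n}l_iv_{n-i}^{p^i}$. Let $\phi:V\to R$ send $v_i\mapsto u_i$ for $1\le i\le h-1$, $v_h\mapsto1$, $v_i\mapsto0$ for $i>h$, and set $F=\phi_*G$. $F$ is a universal deformation of $\mathbb{H}$: a deformation of $\mathbb{H}$ to a complete local ring $A$ with maximal ideal $\mathfrak m$ is a formal group law over $A$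 together with an inclusion $i:\mathbb{F}_{p^h}\to A/\mathfrak m$ such that the reduction of the formal group law mod $\mathfrak m$ is $i_*\mathbb{H}$; a $\star$-isomorphism is an isomorphism of formal group laws $f$ with $f(x)\equiv x$ mod $\mathfrak m$; and for each deformation $(H,i)$ to $A$ there are a unique continuous $\mathbb{W}$-algebra map $\iota:R\to A$ and a unique $\star$-isomorphism $\iota_*F\to H$. $\mathbb{S}_h$ is the automorphism group of $\mathbb{H}$ over $\mathbb{F}_{p^h}$, identified with the unit group of $\mathbb{W}\langle S\rangle/(S^h=p,\ Sa=a^\sigma S)$ ($a\in\mathbb{W}$, $\sigma$ the lift of Frobenius); its elements are written $g=\sum_{i\ge0}g_iS^i$ with $g_i\in\mathbb{W}$, $g_i^{p^h}=g_i$. Action: lift $g\in\mathbb{S}_h$ to $\hat g(x)\in\mathbb{W}[[x]]$ and set $\hat F(x,y)=\hat g^{-1}(F(\hat g(x),\hat g(y)))$. Then $(\hat F,\mathrm{id})$ is a deformation of $\mathbb{H}$ to $R$, so it determines a unique homomorphism $g_*:R\to R$ and a unique $\star$-isomorphism $g_*F\to\hat F$. The composite $h_g:g_*F\to\hat F\xrightarrow{\hat g}F$ is independent of the choice of $\hat g$ and can be written uniquely as a formal sum $h_g(x)=\sum^F_{i\ge0}t_i(g)x^{p^i}$ with $t_i=t_i(g)\in R$; $t_i\equiv g_i$ modulo $(p,u_1,\dots,u_{h-1})$ and $t_0$ is a unit. *)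

(* Defs.v *)
From HB Require Import structures.
From mathcomp Require Import all_boot all_order all_algebra.
From mathcomp Require Import boolp.
(* The import order matters: mpoly shadows the monomials of monalg. *)
From mathcomp Require Import monalg.
From mathcomp Require Import mpoly.

Set Implicit Arguments.
Unset Strict Implicit.
Unset Printing Implicit Defensive.

Import GRing.Theory.
Local Open Scope ring_scope.

(* [mps n A] is the ring A[[x_0, ..., x_(n-1)]], a series being the function
   that gives its coefficients. *)
Record mps (n : nat) (A : Type) := MPS { pscoef :> 'X_{1..n} -> A }.

Lemma mpsP (n : nat) (A : Type) (f g : mps n A) : f =1 g -> f = g.
Proof. by case: f g => [f] [g] /= /funext ->. Qed.

HB.instance Definition _ (n : nat) (A : Type) := gen_eqMixin (mps n A).
HB.instance Definition _ (n : nat) (A : Type) := gen_choiceMixin (mps n A).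

Section PowerSeriesRing.
Variables (n : nat) (A : comNzRingType).
Implicit Types f g e : mps n A.

Definition pszero : mps n A := MPS (fun _ => 0).
Definition psopp f : mps n A := MPS (fun m => - f m).
Definition psadd f g : mps n A := MPS (fun m => f m + g m).

Fact psaddA : associative psadd.
Proof. by move=> f g e; apply: mpsP => m /=; rewrite addrA. Qed.
Fact psaddC : commutative psadd.
Proof. by move=> f g; apply: mpsP => m /=; rewrite addrC. Qed.
Fact psadd0 : left_id pszero psadd.
Proof. by move=> f; apply: mpsP => m /=; rewrite add0r. Qed.
Fact psaddN : left_inverse pszero psopp psadd.
Proof. by move=> f; apply: mpsP => m /=; rewrite addNr. Qed.

HB.instance Definition _ :=
  GRing.isZmodule.Build (mps n A) psaddA psaddC psadd0 psaddN.

Definition psone : mps n A := MPS (fun m => (m == 0%MM)%:R).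
Definition psmul f g : mps n A := MPS (fun m =>
  \sum_(k : 'X_{1..n < (mdeg m).+1, (mdeg m).+1} | m == (k.1 + k.2)%MM)
     f k.1 * g k.2).

Definition pstrunc d f : mpoly n A :=
  \sum_(k : 'X_{1..n < d}) f k *: 'X_[k].

Lemma mcoeff_pstrunc d f m : (mdeg m < d)%N -> (pstrunc d f)@_m = f m.
Proof.
move=> lt_md; rewrite /pstrunc linear_sum /=.
rewrite (bigD1 (BMultinom lt_md)) //= mcoeffZ mcoeffX eqxx mulr1.
rewrite big1 ?addr0 // => k ne_km; rewrite mcoeffZ mcoeffX.
case: eqP => [eq_km|_]; last by rewrite mulr0.
by case/eqP: ne_km; apply: val_inj.
Qed.

Lemma eq_mcoeffM (P P' Q Q' : mpoly n A) m :
  (forall k, (mdeg k <= mdeg m)%N -> P@_k = P'@_k) ->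
  (forall k, (mdeg k <= mdeg m)%N -> Q@_k = Q'@_k) ->
  (P * Q)@_m = (P' * Q')@_m.
Proof.
move=> eqP eqQ; rewrite !mcoeffM; apply: eq_bigr => k _.
by rewrite eqP ?eqQ // -ltnS bmdeg.
Qed.

Lemma psmulE d f g m : (mdeg m < d)%N ->
  psmul f g m = (pstrunc d f * pstrunc d g)@_m.
Proof.
move=> lt_md; rewrite mcoeffM /=; apply: eq_bigr => k _.
by rewrite !mcoeff_pstrunc // (leq_trans _ lt_md) // bmdeg.
Qed.

Fact psmulA : associative psmul.
Proof.
move=> f g e; apply: mpsP => m; have lt_m := ltnSn (mdeg m).
rewrite !(psmulE _ _ lt_m).
transitivity ((pstrunc (mdeg m).+1 f *
  (pstrunc (mdeg m).+1 g * pstrunc (mdeg m).+1 e))@_m).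
  by apply: eq_mcoeffM => // k le_km; rewrite mcoeff_pstrunc // (@psmulE (mdeg m).+1).
rewrite mulrA.
by apply: eq_mcoeffM => // k le_km; rewrite mcoeff_pstrunc // (@psmulE (mdeg m).+1).
Qed.

Fact psmulC : commutative psmul.
Proof.
by move=> f g; apply: mpsP => m; rewrite !(psmulE _ _ (ltnSn _)) mulrC.
Qed.

Fact psmul1 : left_id psone psmul.
Proof.
move=> f; apply: mpsP => m; rewrite (psmulE _ _ (ltnSn _)).
rewrite -[RHS](mcoeff_pstrunc f (ltnSn (mdeg m))) -[in RHS](mul1r (pstrunc _ f)).
by apply: eq_mcoeffM => // k le_km; rewrite mcoeff_pstrunc // mcoeff1.
Qed.

Fact psmulDl : left_distributive psmul psadd.
Proof.
move=> f g e; apply: mpsP => m /=; rewrite -big_split /=.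
by apply: eq_bigr => k _; rewrite mulrDl.
Qed.

Fact psone_neq0 : psone != 0.
Proof.
apply/eqP => /(congr1 (fun f : mps n A => f 0%MM)) /=.
by rewrite eqxx => /eqP; rewrite oner_eq0.
Qed.

HB.instance Definition _ := GRing.Zmodule_isComNzRing.Build (mps n A)
  psmulA psmulC psmul1 psmulDl psone_neq0.

End PowerSeriesRing.

Definition psC (n : nat) (A : comNzRingType) (a : A) : mps n A :=
  MPS (fun m => a *+ (m == 0%MM)).

Definition psX (n : nat) (A : comNzRingType) (i : 'I_n) : mps n A :=
  MPS (fun m => (m == U_(i)%MM)%:R).

Definition psmap (n : nat) (A B : Type) (phi : A -> B) (f : mps n A) : mps n B :=
  MPS (fun m => phi (f m)).

(* Substitution f(a_0, ..., a_(n-1)).  When the a_i have no constant term, the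
   monomials of f of degree > mdeg d do not contribute to the coefficient of d,
   so that the sum below is the full one.  It is only used in that case. *)
Definition pssubst (n m : nat) (A : comNzRingType)
    (f : mps n A) (a : 'I_n -> mps m A) : mps m A :=
  MPS (fun d => \sum_(k : 'X_{1..n < (mdeg d).+1})
                   f k * (\prod_(i < n) a i ^+ k i) d).

Definition pscomp (m : nat) (A : comNzRingType) (f : mps 1 A) (a : mps m A) :
  mps m A := pssubst f (fun _ => a).

Definition ps2 (m : nat) (A : comNzRingType) (F : mps 2 A) (a b : mps m A) :
  mps m A := pssubst F (tnth [tuple a; b]).

Notation psX1 := (psX _ (ord0 : 'I_1)).

Definition comp_inverse (A : comNzRingType) (f g : mps 1 A) : Prop :=
  [/\ f 0%MM = 0, g 0%MM = 0, pscomp f g = psX1 & pscomp g f = psX1].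

Definition var2 (A : comNzRingType) (i : nat) : mps 2 A := psX A (inord i).
Definition var3 (A : comNzRingType) (i : nat) : mps 3 A := psX A (inord i).

Record is_fgl (A : comNzRingType) (F : mps 2 A) : Prop := IsFgl {
  fgl_0l : ps2 F 0 psX1 = psX1 :> mps 1 A;
  fgl_0r : ps2 F psX1 0 = psX1 :> mps 1 A;
  fgl_C : ps2 F (var2 A 1) (var2 A 0) = F;
  fgl_A : ps2 F (var3 A 0) (ps2 F (var3 A 1) (var3 A 2)) =
          ps2 F (ps2 F (var3 A 0) (var3 A 1)) (var3 A 2) }.

Definition fgl_iso (A : comNzRingType) (F G : mps 2 A) (f : mps 1 A) : Prop :=
  (exists f', comp_inverse f f') /\
  pscomp f F = ps2 G (pscomp f (var2 A 0)) (pscomp f (var2 A 1)).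

Fixpoint fgl_psum (A : comNzRingType) (F : mps 2 A) (a : nat -> mps 1 A)
    (n : nat) : mps 1 A :=
  if n is n'.+1 then ps2 F (fgl_psum F a n') (a n') else 0.

Definition fgl_series (A : comNzRingType) (F : mps 2 A) (n : nat) : mps 1 A :=
  fgl_psum F (fun _ => psX1) n.

(* s is the infinite formal sum of the a_i: every coefficient of the partial
   sums is eventually that of s. *)
Definition is_fgl_sum (A : comNzRingType) (F : mps 2 A) (a : nat -> mps 1 A)
    (s : mps 1 A) : Prop :=
  forall m, exists N, forall n, (N <= n)%N -> fgl_psum F a n m = s m.

Section PLocal.
Variable p : nat.

Definition plocal_pred : {pred rat} := fun x => coprime p `|denq x|%N.

Lemma plocalP (x : rat) :
  reflect (exists (a : int) (d : nat), coprime p d /\ d%:R * x = a%:~R)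
          (x \in plocal_pred).
Proof.
apply: (iffP idP) => [px|[a [d [pd dx]]]].
  exists (numq x), `|denq x|%N; split=> //.
  rewrite numqE mulrC; congr (_ * _).
  by rewrite -[denq x in RHS]absz_denq.
suff dvd_d : (`|denq x| %| d)%N by apply: coprime_dvdr dvd_d pd.
have : (d%:Z * numq x = a * denq x)%R.
  apply: (@intr_inj rat); rewrite !intrM /= numqE -dx.
  by rewrite mulrA.
move=> /(congr1 absz); rewrite !abszM /= => eq_d.
rewrite -(@Gauss_dvdl _ _ `|numq x|%N) ?eq_d ?dvdn_mull //.
by rewrite coprime_sym coprime_num_den.
Qed.

Fact plocal_subring : subring_closed plocal_pred.
Proof.
split=> [|x y /plocalP[a [d [pd dx]]] /plocalP[b [e [pe ey]]]
         |x y /plocalP[a [d [pd dx]]] /plocalP[b [e [pe ey]]]]; apply/plocalP.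
- by exists 1, 1%N; rewrite coprimen1 mulr1.
- exists (a * e%:Z - b * d%:Z), (d * e)%N; split; first by rewrite coprimeMr pd.
  rewrite natrM intrB !intrM -dx -ey /= mulrBr.
  by rewrite mulrAC -mulrA (mulrC d%:R e%:R) -!mulrA ![_ * d%:R]mulrC.
- exists (a * b), (d * e)%N; split; first by rewrite coprimeMr pd.
  by rewrite natrM intrM -dx -ey mulrACA.
Qed.

HB.instance Definition _ := GRing.isSubringClosed.Build rat plocal_pred
  plocal_subring.

Record plocal := PLocal { plocal_val :> rat; _ : plocal_val \in plocal_pred }.

HB.instance Definition _ := [isSub for plocal_val].
HB.instance Definition _ := [Choice of plocal by <:].
HB.instance Definition _ := [SubChoice_isSubComNzRing of plocal by <:].

(* V = Z_(p)[v_1, v_2, ...] and its rationalization; the variable of index i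
   in the monomial algebra stands for v_(i+1). *)
Definition ptypV : comNzRingType := {malg plocal[{cmonom nat}]}.
Definition ptypVQ : comNzRingType := {malg rat[{cmonom nat}]}.

Definition ptypV_to_Q (x : ptypV) : ptypVQ :=
  monalg.mmap (fun c => (plocal_val c)%:A : {malg rat[{cmonom nat}]})
              (fun m => << m >> : {malg rat[{cmonom nat}]}) x.

Definition araki (i : nat) : ptypV :=
  if i is j.+1 then << ucm j >> else p%:R.

Definition is_araki_log (l : nat -> ptypVQ) : Prop :=
  l 0%N = 1 /\
  forall n, p%:R * l n =
    \sum_(i < n.+1) l i * ptypV_to_Q (araki (n - i)) ^+ (p ^ i).

Definition log_series (A : comNzRingType) (l : nat -> A) : mps 1 A :=
  MPS (fun m => \sum_(i < (mdeg m).+1 | mdeg m == (p ^ i)%N) l i).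

(* V is torsion free, so the logarithm determines G. *)
Definition is_universal_ptypical (G : mps 2 ptypV) : Prop :=
  is_fgl G /\
  exists2 l : nat -> ptypVQ, is_araki_log l &
    pscomp (log_series l) (psmap ptypV_to_Q G) =
    pscomp (log_series l) (var2 ptypVQ 0) + pscomp (log_series l) (var2 ptypVQ 1).

(* V represents p-typical formal group laws: those over A are the
   push-forwards of G. *)
Definition ptypical (G : mps 2 ptypV) (A : comNzRingType) (H : mps 2 A) : Prop :=
  exists psi : {rmorphism ptypV -> A}, H = psmap psi G.

Definition is_honda (G : mps 2 ptypV) (h : nat) (H : mps 2 'F_p) : Prop :=
  [/\ is_fgl H, ptypical G H & fgl_series H p = psX1 ^+ (p ^ h)].

End PLocal.

(* (W, red : W -> k) is the ring of Witt vectors of the perfect field k of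
   characteristic p with its projection to k, i.e. the strict p-ring with
   residue ring k; this determines it up to unique isomorphism. *)
Record is_witt (p : nat) (k W : comNzRingType) (red : {rmorphism W -> k}) : Prop :=
 IsWitt {
  witt_surj : forall x : k, exists a : W, red a = x;
  witt_ker : forall a : W, red a = 0 <-> exists b, a = p%:R * b;
  witt_torsion_free : forall a : W, p%:R * a = 0 -> a = 0;
  witt_separated : forall a : W, (forall n, exists b, a = p%:R ^+ n * b) -> a = 0;
  witt_complete : forall s : nat -> W,
    (forall n, exists b, s n.+1 - s n = p%:R ^+ n * b) ->
    exists a, forall n, exists b, a - s n = p%:R ^+ n * b }.

Definition ideal_gen (A : comNzRingType) (n : nat) (x : nat -> A) (a : A) : Prop :=
  exists c : nat -> A, a = \sum_(j < n) c j * x j.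

Fixpoint ideal_pow (A : comNzRingType) (I : A -> Prop) (n : nat) (a : A) : Prop :=
  if n is n'.+1 then
    exists2 s : seq (A * A),
      {in s, forall bc, I bc.1 /\ ideal_pow I n' bc.2} &
      a = \sum_(bc <- s) bc.1 * bc.2
  else True.

Definition continuous_adic (A : comNzRingType) (I : A -> Prop) (f : A -> A) : Prop :=
  forall n, exists N, forall a, ideal_pow I N a -> ideal_pow I n (f a).

Section LubinTate.
Variables (p h : nat) (W : comNzRingType).

(* R = W[[u_1, ..., u_(h-1)]] *)
Definition lubin_tate : comNzRingType := mps h.-1 W.

(* The parameters u_i of R (0 < i < h), with u_0 = p; the power series variable
   of index i is u_(i+1). *)
Definition lt_u (i : nat) : lubin_tate :=
  if i is j.+1 then oapp (@psX h.-1 W) 0 (insub j) else p%:R.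

(* I_n = (p, u_1, ..., u_(n-1)); I_h is the maximal ideal. *)
Definition lt_ideal (n : nat) : lubin_tate -> Prop := ideal_gen n lt_u.

Definition is_lt_phi (phi : ptypV p -> lubin_tate) : Prop :=
  forall i, (0 < i)%N ->
    phi (araki p i) = if (i < h)%N then lt_u i else (i == h)%:R.

(* An isomorphism f : F -> G with f(x) = x modulo the maximal ideal. *)
Definition star_iso (F G : mps 2 lubin_tate) (f : mps 1 lubin_tate) : Prop :=
  fgl_iso F G f /\
  forall m, lt_ideal h (f m - (psX1 : mps 1 lubin_tate) m).

(* F^(x,y) = g^-1(F(g(x), g(y))), where g' is the inverse of g. *)
Definition fgl_conj (F : mps 2 lubin_tate) (g g' : mps 1 lubin_tate) :
  mps 2 lubin_tate :=
  pscomp g' (ps2 F (pscomp g (var2 _ 0)) (pscomp g (var2 _ 1))).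

(* t_i = t_i(g) for all i.  The map gs is g_* : R -> R, and f is the
   star-isomorphism g_* F -> F^; h_g is the composite of f and of the lift of
   g.  By the universal property of F, gs and f exist and are unique for each
   lift of g, and the t_i do not depend on that lift. *)
Definition is_stabilizer_coord (k : comNzRingType) (red : W -> k)
    (F : mps 2 lubin_tate) (g : mps 1 k) (t : nat -> lubin_tate) : Prop :=
  exists (ghat ghat' : mps 1 W) (gs : {rmorphism lubin_tate -> lubin_tate})
         (f : mps 1 lubin_tate),
    let gR := psmap (@psC h.-1 W) ghat in
    let gR' := psmap (@psC h.-1 W) ghat' in
    [/\ psmap red ghat = g /\ comp_inverse ghat ghat',
        forall a : W, gs (psC _ a) = psC _ a,
        continuous_adic (lt_ideal h) gs,
        star_iso (psmap gs F) (fgl_conj F gR gR') f &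
        is_fgl_sum F (fun i => psC _ (t i) * psX1 ^+ (p ^ i)) (pscomp gR f)].

End LubinTate.

(* Main.v *)
(* Let B = R / I_(h-1), where p = u_1 = ... = u_(h-2) = 0; put q = p^(h-1),
   u = u_(h-1) and w = g_*(u).  Over B the Araki generators give
   [p]_F(x) = u x^q +_F x^(p^h), and F(x, y) = x + y modulo degree q because
   the logarithm, after killing v_1, ..., v_(h-2) rationally, has no term of
   degree p, ..., p^(h-2).  Comparing h_g([p]_(g_* F)(x)) with [p]_F(h_g(x))
   yields
     t_0 w x^q +_F sum^F_j (t_(j+1) w^(p^(j+1)) x^(p^(h+j)) +_F t_j x^(p^(h+j)))
     = u t_0^q x^q
         +_F sum^F_j (u t_(j+1)^q x^(p^(h+j)) +_F t_j^(p^h) x^(p^(h+j))).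
   The leading terms agree, whence w = u t_0^(q-1), and can be cancelled.  What
   remains has order p^h, so that its formal sums are ordinary sums modulo
   degree p^h q = p^(2h-1), and the coefficients of x^(p^(h+i)) for i < h - 1
   give the theorem. *)
Require Import Defs.
From HB Require Import structures.
From mathcomp Require Import all_boot all_order all_algebra.
From mathcomp Require Import finmap boolp monalg mpoly.

Set Implicit Arguments.
Unset Strict Implicit.
Unset Printing Implicit Defensive.

Import GRing.Theory.
Local Open Scope ring_scope.

(** * Power series and substitution *)

(** Congruence modulo terms of total degree at least [d]; thus [f =_[d] 0] says that [f] has order
    at least [d]. Infinite formal sums are studied through such truncations. *)
Definition eqps (n : nat) (A : Type) (d : nat) (f g : mps n A) :=
  forall m, (mdeg m < d)%N -> f m = g m.

Notation "f =_[ d ] g" := (eqps d f g)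
  (at level 70, d at level 0, g at next level).

Section Congruence.
Variable n : nat.

Lemma eqps_refl (A : Type) d (f : mps n A) : f =_[d] f.
Proof. by []. Qed.

Lemma eqps_sym (A : Type) d (f g : mps n A) : f =_[d] g -> g =_[d] f.
Proof. by move=> fg m /fg. Qed.

Lemma eqps_trans (A : Type) d (g f e : mps n A) :
  f =_[d] g -> g =_[d] e -> f =_[d] e.
Proof. by move=> fg ge m lt_m; rewrite fg ?ge. Qed.

Lemma eqpsW (A : Type) d e (f g : mps n A) :
  f =_[d] g -> (e <= d)%N -> f =_[e] g.
Proof. by move=> fg le_ed m lt_m; apply/fg/(leq_trans lt_m). Qed.

Lemma eqpsP (A : Type) (f g : mps n A) : (forall d, f =_[d] g) -> f = g.
Proof. by move=> fg; apply: mpsP => m; apply: (fg (mdeg m).+1). Qed.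

Lemma eqps_map (A B : Type) d (phi : A -> B) (f g : mps n A) :
  f =_[d] g -> psmap phi f =_[d] psmap phi g.
Proof. by move=> fg m lt_m /=; rewrite fg. Qed.

Variable A : comNzRingType.
Implicit Types f g : mps n A.

Lemma eqps1 f : f 0%MM = 0 <-> f =_[1] 0.
Proof.
split=> [f0 m|-> //]; last by rewrite mdeg0.
by rewrite ltnS leqn0 mdeg_eq0 => /eqP ->.
Qed.

Lemma eqpsD d f f' g g' : f =_[d] f' -> g =_[d] g' -> f + g =_[d] f' + g'.
Proof. by move=> ff' gg' m lt_m /=; rewrite /= ff' ?gg'. Qed.

Lemma eqpsN d f f' : f =_[d] f' -> - f =_[d] - f'.
Proof. by move=> ff' m lt_m /=; rewrite /= ff'. Qed.

Lemma eqpsB d f f' g g' : f =_[d] f' -> g =_[d] g' -> f - g =_[d] f' - g'.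
Proof. by move=> ff' gg'; apply/eqpsD/eqpsN. Qed.

Lemma eqps_sum d (I : Type) (r : seq I) (P : pred I) (F G : I -> mps n A) :
  (forall i, P i -> F i =_[d] G i) ->
  \sum_(i <- r | P i) F i =_[d] \sum_(i <- r | P i) G i.
Proof.
move=> FG; elim/big_rec2: _ => // i x y Pi xy.
by apply: eqpsD => //; apply: FG.
Qed.

Lemma eqps_sum0 d (I : Type) (r : seq I) (P : pred I) (F : I -> mps n A) :
  (forall i, P i -> F i =_[d] 0) -> \sum_(i <- r | P i) F i =_[d] 0.
Proof.
move=> F0; elim/big_rec: _ => // i x Pi x0.
by rewrite -[0]addr0; apply: eqpsD => //; apply: F0.
Qed.

Lemma eqpsM_ord d e f g : f =_[d] 0 -> g =_[e] 0 -> f * g =_[d + e] 0.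
Proof.
move=> f0 g0 m lt_m; rewrite [LHS]/= big1 // =>
  -[[k1 lt1] [k2 lt2]] /= /eqP def_m.
have [/f0 ->|le_d] := ltnP (mdeg k1) d; first by rewrite mul0r.
have [/g0 ->|le_e] := ltnP (mdeg k2) e; first by rewrite mulr0.
by move: lt_m; rewrite def_m mdegD ltnNge leq_add.
Qed.

Lemma eqpsM d f f' g g' : f =_[d] f' -> g =_[d] g' -> f * g =_[d] f' * g'.
Proof.
move=> ff' gg'.
suff: f * g - f' * g' =_[d] 0.
  by move=> fg0 m /fg0 /eqP; rewrite [_ - _]/= subr_eq0 => /eqP.
have ->: f * g - f' * g' = (f - f') * g + f' * (g - g').
  by rewrite mulrBl mulrBr addrA subrK.
rewrite -[0]addr0; apply: eqpsD.
  rewrite -[d]addn0; apply: eqpsM_ord => // m /ff' /=.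
  by move=> ->; rewrite subrr.
rewrite -[d]add0n; apply: eqpsM_ord => // m /gg' /=.
by move=> ->; rewrite subrr.
Qed.

Lemma eqpsX d i f f' : f =_[d] f' -> f ^+ i =_[d] f' ^+ i.
Proof.
by move=> ff'; elim: i => // i IHi; rewrite !exprS; apply: eqpsM.
Qed.

Lemma eqpsX_ord d i f : f =_[d] 0 -> f ^+ i =_[d * i] 0.
Proof.
move=> f0; elim: i => [|i IHi]; first by rewrite muln0.
by rewrite exprS mulnS; apply: eqpsM_ord.
Qed.

Lemma eqps_prod d (I : Type) (r : seq I) (P : pred I) (F G : I -> mps n A) :
  (forall i, P i -> F i =_[d] G i) ->
  \prod_(i <- r | P i) F i =_[d] \prod_(i <- r | P i) G i.
Proof.
move=> FG; elim/big_rec2: _ => // i x y Pi xy.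
by apply: eqpsM => //; apply: FG.
Qed.

Lemma eqps_subr d f g : f - g =_[d] 0 <-> f =_[d] g.
Proof.
split=> fg m lt_m; last by rewrite /= fg // subrr.
by apply/eqP; rewrite -subr_eq0; apply/eqP/fg.
Qed.

Lemma pstruncP d f : MPS (fun m => (pstrunc d f)@_m) =_[d] f.
Proof. by move=> m lt_m; apply: mcoeff_pstrunc. Qed.

Fact psC_is_zmod_morphism : zmod_morphism (@psC n A).
Proof. by move=> a b; apply: mpsP => m /=; rewrite mulrnBl. Qed.
HB.instance Definition _ :=
  GRing.isZmodMorphism.Build A (mps n A) (@psC n A) psC_is_zmod_morphism.

Lemma psCM_coef a f m : (psC n a * f) m = a * f m.
Proof.
have lt0 : (mdeg (0%MM : 'X_{1..n}) < (mdeg m).+1)%N by rewrite mdeg0.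
rewrite [LHS]/= (bigD1 (BMultinom lt0, BMultinom (ltnSn (mdeg m)))) /=;
  last by rewrite add0m.
rewrite eqxx mulr1n big1 ?addr0 // => -[[k1 lt1] [k2 lt2]] /andP[/= /eqP def_m].
case: (eqVneq k1 0%MM) => [k10|_]; last by rewrite mulr0n mul0r.
case/eqP; congr (_, _); apply: val_inj => //=.
by rewrite def_m k10 add0m.
Qed.

Fact psC_is_monoid_morphism : monoid_morphism (@psC n A).
Proof.
split=> [|a b]; first by apply: mpsP => m /=.
by apply: mpsP => m; rewrite psCM_coef /= mulrnAr.
Qed.
HB.instance Definition _ :=
  GRing.isMonoidMorphism.Build A (mps n A) (@psC n A) psC_is_monoid_morphism.

Lemma coef_sum (I : Type) (r : seq I) (P : pred I) (F : I -> mps n A) m :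
  (\sum_(i <- r | P i) F i) m = \sum_(i <- r | P i) F i m.
Proof. by elim/big_rec2: _ => // i x y _ <-. Qed.

Definition mpoly_ps (P : mpoly n A) : mps n A := MPS (fun m => P@_m).

Lemma mpoly_psM P Q : mpoly_ps (P * Q) = mpoly_ps P * mpoly_ps Q.
Proof. by apply: mpsP => m; rewrite /= mcoeffM. Qed.

End Congruence.

Lemma psX_eq0 n (A : comNzRingType) (i : 'I_n) : psX A i 0%MM = 0.
Proof. by rewrite /= eq_sym mnm1_eq0. Qed.

#[local] Hint Resolve eqps_refl psX_eq0 : core.

(** * Substitution as a morphism of rings *)

Section Substitution.
Variables (n m : nat) (A : comNzRingType).
Implicit Types (f g : mps n A) (a b : 'I_n -> mps m A) (P Q : mpoly n A).

Local Notation ev a := (mpoly.mmap (@psC m A) a).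

Lemma prod_ord d a (k : 'X_{1..n}) : (forall i, a i =_[d] 0) ->
  \prod_(i < n) a i ^+ k i =_[d * mdeg k] 0.
Proof.
move=> a0; rewrite mdegE.
suff: forall (r : seq 'I_n),
    \prod_(i <- r) a i ^+ k i =_[d * \sum_(i <- r) k i] 0 by apply.
elim=> [|i r IHr]; first by rewrite !big_nil muln0.
by rewrite !big_cons mulnDr; apply: eqpsM_ord => //; apply: eqpsX_ord.
Qed.

(** This link to polynomial evaluation lets substitution inherit its ring laws from [mmap]. *)
Lemma pssubstE f a mu : pssubst f a mu = ev a (pstrunc (mdeg mu).+1 f) mu.
Proof.
rewrite /pstrunc raddf_sum coef_sum; apply: eq_bigr => k _.
by rewrite /= mmapZ mmapX psCM_coef.
Qed.

(** As the [a i] have no constant term, a monomial of degree at least [d] evaluates to a series of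
    order at least [d]. *)
Lemma ev_eqps d a P Q : (forall i, a i 0%MM = 0) ->
  (forall k, (mdeg k < d)%N -> P@_k = Q@_k) -> ev a P =_[d] ev a Q.
Proof.
move=> a0 PQ; apply/eqps_subr; rewrite -raddfB /= /mpoly.mmap.
rewrite big_seq; apply: eqps_sum0 => k k_in mu lt_mu; rewrite psCM_coef.
rewrite (prod_ord (d := 1)) ?mulr0 //; first by move=> i; apply/eqps1.
rewrite mul1n (leq_trans lt_mu) // leqNgt; apply: contraL k_in => lt_k.
by rewrite mcoeff_msupp negbK mcoeffB PQ ?subrr.
Qed.

Lemma pssubst_ev d f a P : (forall i, a i 0%MM = 0) ->
  f =_[d] mpoly_ps P -> pssubst f a =_[d] ev a P.
Proof.
move=> a0 fP mu lt_mu; rewrite pssubstE;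
  apply: (@ev_eqps (mdeg mu).+1) => // k lt_k.
by rewrite mcoeff_pstrunc // fP // (leq_trans lt_k).
Qed.

Lemma eqps_substl d f g a : f =_[d] g -> pssubst f a =_[d] pssubst g a.
Proof.
move=> fg mu lt_mu; apply: eq_bigr => k _; rewrite fg //.
by apply: leq_trans lt_mu; rewrite ltnS -ltnS bmdeg.
Qed.

Lemma eqps_substr d f a b : (forall i, a i =_[d] b i) ->
  pssubst f a =_[d] pssubst f b.
Proof.
move=> ab mu lt_mu; apply: eq_bigr => k _; congr (_ * _).
by apply: (eqps_prod (d := d)) => // i _; apply: eqpsX.
Qed.

Lemma pssubst_ord d e f a : f =_[d] 0 -> (forall i, a i =_[e] 0) ->
  pssubst f a =_[e * d] 0.
Proof.
move=> f0 a0 mu lt_mu; apply: big1 => k _.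
have [/f0 ->|le_d] := ltnP (mdeg k) d; first by rewrite mul0r.
by rewrite (prod_ord a0) ?mulr0 // (leq_trans lt_mu) // leq_mul2l le_d orbT.
Qed.

Section Morphism.
Variables (a : 'I_n -> mps m A) (a0 : forall i, a i 0%MM = 0).

(* The proof is an argument so that [pseval a0] can carry a canonical ring
   morphism structure. *)
Definition pseval of (forall i, a i 0%MM = 0) := fun f => pssubst f a.

Fact pseval_is_zmod_morphism : zmod_morphism (pseval a0).
Proof.
move=> f g; apply: mpsP => mu; rewrite /= -sumrB.
by apply: eq_bigr => k _; rewrite mulrBl.
Qed.
HB.instance Definition _ :=
  GRing.isZmodMorphism.Build _ _ (pseval a0) pseval_is_zmod_morphism.

(** Modulo degree [d] both factors may be replaced by polynomial truncations, on which evaluation is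
    multiplicative. *)
Fact pseval_is_monoid_morphism : monoid_morphism (pseval a0).
Proof.
have evE d (f : mps n A) : pseval a0 f =_[d] ev a (pstrunc d f).
  by apply: pssubst_ev => //; apply/eqps_sym/pstruncP.
split=> [|f g]; apply: eqpsP => d.
  rewrite -(rmorph1 (ev a)); apply: pssubst_ev => // k _.
  by rewrite /= mcoeff1.
apply: (eqps_trans (g := ev a (pstrunc d f * pstrunc d g))).
  apply: pssubst_ev => //; rewrite mpoly_psM.
  by apply: eqpsM; apply/eqps_sym/pstruncP.
by rewrite rmorphM; apply: eqpsM; apply/eqps_sym.
Qed.
HB.instance Definition _ :=
  GRing.isMonoidMorphism.Build _ _ (pseval a0) pseval_is_monoid_morphism.

Lemma pssubstX i : pssubst (psX A i) a = a i.
Proof.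
apply: eqpsP => d; apply: (eqps_trans (g := ev a 'X_i)).
  by apply: pssubst_ev => // k _; rewrite /= mcoeffX eq_sym.
by rewrite mmapX mmap1U.
Qed.

Lemma pssubstC c : pssubst (psC n c) a = psC m c.
Proof.
apply: eqpsP => d; apply: (eqps_trans (g := ev a c%:MP)).
  by apply: pssubst_ev => // k _; rewrite /= mcoeffC eq_sym mulr_natr.
by rewrite mmapC.
Qed.

Lemma pssubst_coef0 f : pssubst f a 0%MM = f 0%MM.
Proof.
transitivity (pssubst (psC n (f 0%MM)) a 0%MM).
  apply: (eqps_substl (d := 1)) => [k|]; rewrite ?mdeg0 //.
  by rewrite ltnS leqn0 mdeg_eq0 => /eqP -> /=; rewrite eqxx.
by rewrite pssubstC /= eqxx.
Qed.

End Morphism.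

End Substitution.

(** Modulo degree [d] the outer series is a polynomial in the [a i], and the ring morphism [pseval]
    commutes with polynomials. *)
Lemma pssubstA n m l (A : comNzRingType) (f : mps n A) (a : 'I_n -> mps m A)
    (b : 'I_m -> mps l A) :
  (forall i, a i 0%MM = 0) -> (forall i, b i 0%MM = 0) ->
  pssubst (pssubst f a) b = pssubst f (fun i => pssubst (a i) b).
Proof.
move=> a0 b0; apply: eqpsP => d.
have ab0 i : pssubst (a i) b 0%MM = 0 by rewrite pssubst_coef0.
apply: (eqps_trans (g := pssubst (mpoly.mmap (@psC m A) a (pstrunc d f)) b)).
  by apply/eqps_substl/pssubst_ev => //; apply/eqps_sym/pstruncP.
apply: (eqps_trans (g := mpoly.mmap (@psC l A) (fun i => pssubst (a i) b)
                           (pstrunc d f))); last first.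
  by apply/eqps_sym/pssubst_ev => //; apply/eqps_sym/pstruncP.
suff -> : pssubst (mpoly.mmap (@psC m A) a (pstrunc d f)) b =
  mpoly.mmap (@psC l A) (fun i => pssubst (a i) b) (pstrunc d f) by [].
rewrite -[LHS]/(pseval b0 _) /mpoly.mmap rmorph_sum; apply: eq_bigr => k _.
rewrite rmorphM /= [pseval b0 (psC _ _)]pssubstC // rmorph_prod.
by congr (_ * _); apply: eq_bigr => i _; rewrite rmorphXn.
Qed.

(** * Change of coefficient ring *)

Section Map.
Variables (A B : comNzRingType) (phi : {rmorphism A -> B}).

Fact psmap_is_zmod_morphism n : zmod_morphism (@psmap n A B phi).
Proof. by move=> f g; apply: mpsP => m /=; rewrite rmorphB. Qed.
HB.instance Definition _ n :=
  GRing.isZmodMorphism.Build _ _ (@psmap n A B phi) (@psmap_is_zmod_morphism n).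

Fact psmap_is_monoid_morphism n : monoid_morphism (@psmap n A B phi).
Proof.
split=> [|f g]; apply: mpsP => m /=; first by rewrite rmorph_nat.
by rewrite rmorph_sum; apply: eq_bigr => k _; rewrite rmorphM.
Qed.
HB.instance Definition _ n :=
  GRing.isMonoidMorphism.Build _ _ (@psmap n A B phi)
    (@psmap_is_monoid_morphism n).

Lemma psmapC n a : psmap phi (psC n a) = psC n (phi a).
Proof. by apply: mpsP => m /=; rewrite rmorphMn. Qed.

Lemma psmapX n (i : 'I_n) : psmap phi (psX A i) = psX B i.
Proof. by apply: mpsP => m /=; rewrite rmorph_nat. Qed.

Lemma psmap_subst n m (f : mps n A) (a : 'I_n -> mps m A) :
  psmap phi (pssubst f a) = pssubst (psmap phi f) (fun i => psmap phi (a i)).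
Proof.
apply: mpsP => mu /=; rewrite rmorph_sum; apply: eq_bigr => k _.
rewrite rmorphM; congr (_ * _); rewrite -[LHS]/(psmap phi _ mu) rmorph_prod.
by congr pscoef; apply: eq_bigr => i _; rewrite rmorphXn.
Qed.

End Map.

(** * Formal group laws *)

Section Univariate.
Variable A : comNzRingType.

Lemma mdeg_inj1 : injective (@mdeg 1).
Proof.
move=> k l; rewrite !mdegE !big_ord1 => eq_kl.
by apply/mnmP => i; rewrite ord1.
Qed.

Lemma psX1Xn_coef j (m : 'X_{1..1}) :
  (psX1 ^+ j : mps 1 A) m = (mdeg m == j)%:R.
Proof.
have -> : psX1 ^+ j = mpoly_ps ('X_ord0 ^+ j) :> mps 1 A.
  elim: j => [|j IHj]; first by apply: mpsP => k; rewrite /= mcoeff1.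
  rewrite !exprS mpoly_psM -IHj; congr (_ * _).
  by apply: mpsP => k; rewrite /= mcoeffX eq_sym.
rewrite /= mpolyXn mcoeffX; congr (nat_of_bool _)%:R.
apply/eqP/eqP => [<-|]; first by rewrite mdegMn mdeg1 mul1n.
by move=> def_j; apply: mdeg_inj1; rewrite mdegMn mdeg1 mul1n.
Qed.

Definition psmon (a : A) (d : nat) : mps 1 A := psC 1 a * psX1 ^+ d.

Lemma psmonE a d m : psmon a d m = a *+ (mdeg m == d).
Proof. by rewrite /psmon psCM_coef psX1Xn_coef mulr_natr. Qed.

Lemma psmon_ord a d : psmon a d =_[d] 0.
Proof. by move=> m lt_m; rewrite psmonE ltn_eqF. Qed.

Lemma psmon_coef0 a d : (0 < d)%N -> psmon a d 0%MM = 0.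
Proof. by move=> d_gt0; rewrite psmonE mdeg0 ltn_eqF. Qed.

Lemma psmon0 d : psmon 0 d = 0.
Proof. by rewrite /psmon rmorph0 mul0r. Qed.

Lemma psmon1 : psmon 1 1 = psX1.
Proof. by rewrite /psmon rmorph1 mul1r. Qed.

Lemma psmonX a d e : psmon a d ^+ e = psmon (a ^+ e) (d * e).
Proof. by rewrite /psmon exprMn -rmorphXn -exprM. Qed.

Lemma psmonM a b d : psC 1 a * psmon b d = psmon (a * b) d.
Proof. by rewrite /psmon mulrA -rmorphM. Qed.

Lemma pscomp_mon n a d (f : mps n A) : f 0%MM = 0 ->
  pscomp (psmon a d) f = psC n a * f ^+ d.
Proof.
move=> f0; have a0 (i : 'I_1) : f 0%MM = 0 by [].
rewrite -[LHS]/(pseval a0 _) /psmon rmorphM rmorphXn /=.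
by rewrite [pseval _ (psX _ _)]pssubstX // [pseval _ _]pssubstC.
Qed.

Lemma pscompX n (f : mps n A) : f 0%MM = 0 -> pscomp psX1 f = f.
Proof. by move=> f0; apply: pssubstX. Qed.

Lemma pscompX1r (f : mps 1 A) : pscomp f psX1 = f.
Proof.
apply: eqpsP => d; apply: (eqps_trans (g := mpoly.mmap (@psC 1 A) (fun=>
  psX1) (pstrunc d f))).
  by apply: pssubst_ev => //; apply/eqps_sym/pstruncP.
apply: (eqps_trans (g := mpoly_ps (pstrunc d f))); last exact: pstruncP.
move=> m _; rewrite /mpoly.mmap coef_sum.
rewrite -[RHS]/((pstrunc d f)@_m) [in RHS](mpolyE (pstrunc d f)) raddf_sum.
apply: eq_bigr => k _; rewrite psCM_coef [RHS]mcoeffZ mcoeffX /mmap1 big_ord1.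
rewrite psX1Xn_coef; congr (_ * (nat_of_bool _)%:R).
apply/eqP/eqP => [def_m|->]; last by rewrite mdegE big_ord1.
by apply: mdeg_inj1; rewrite def_m mdegE big_ord1.
Qed.

Lemma pscompA n (f g : mps 1 A) (e : mps n A) : g 0%MM = 0 -> e 0%MM = 0 ->
  pscomp (pscomp f g) e = pscomp f (pscomp g e).
Proof. by move=> g0 e0; apply: pssubstA. Qed.

Lemma pscomp_coef0 n (f : mps 1 A) (g : mps n A) :
  g 0%MM = 0 -> pscomp f g 0%MM = f 0%MM.
Proof. by move=> g0; apply: pssubst_coef0. Qed.

Lemma pscompB n (f g : mps 1 A) (e : mps n A) :
  pscomp (f - g) e = pscomp f e - pscomp g e.
Proof.
by apply: mpsP => m; rewrite /= -sumrB; apply: eq_bigr => k _; rewrite mulrBl.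
Qed.

Lemma eqps_comp n d (f g : mps 1 A) (a b : mps n A) :
  f =_[d] g -> a =_[d] b -> pscomp f a =_[d] pscomp g b.
Proof.
move=> fg ab; apply: (eqps_trans (g := pscomp g a)); first exact: eqps_substl.
exact: eqps_substr.
Qed.

(* Congruence gains one degree because f has no linear term. *)
Lemma eqps_comp_succ n d (f : mps 1 A) (a b : mps n A) :
  f =_[2] 0 -> a 0%MM = 0 -> b 0%MM = 0 -> a =_[d] b ->
  pscomp f a =_[d.+1] pscomp f b.
Proof.
move=> f0 /eqps1 a0 /eqps1 b0 ab.
have abX j : (1 < j)%N -> a ^+ j =_[d.+1] b ^+ j.
  (* Here a^j - b^j is a - b times a sum of products a^(j-1-i) b^i, each of positive order as j > 1;
     this gives the extra degree. *)
  move=> gt1; apply/eqps_subr; rewrite subrXX -addn1.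
  apply: eqpsM_ord; first exact/eqps_subr.
  apply: eqps_sum0 => -[i lt_i] _ /=.
  have [i0|i_gt0] := posnP i; last first.
    apply: (eqpsM_ord (d := 0) (e := 1)) => //.
    by apply: eqpsW (eqpsX_ord b0) _; rewrite mul1n.
  rewrite i0 expr0 mulr1 subn0; apply: eqpsW (eqpsX_ord a0) _.
  by rewrite mul1n -subn1 subn_gt0.
move=> m lt_m; apply: eq_bigr => k _; rewrite !big_ord1.
have [/f0 ->|] := ltnP (mdeg k) 2; first by rewrite !mul0r.
by rewrite mdegE big_ord1 => /abX ->.
Qed.

End Univariate.

Section TwoVariables.
Variable A : comNzRingType.
Implicit Types F : mps 2 A.

Lemma tnth2_coef0 n (a b : mps n A) : a 0%MM = 0 -> b 0%MM = 0 ->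
  forall i, tnth [tuple a; b] i 0%MM = 0.
Proof. by move=> a0 b0 [[|[|//]] lt_i]; rewrite (tnth_nth 0). Qed.

Lemma ps2_coef0 n F (a b : mps n A) : a 0%MM = 0 -> b 0%MM = 0 ->
  ps2 F a b 0%MM = F 0%MM.
Proof. by move=> a0 b0; apply/pssubst_coef0/tnth2_coef0. Qed.

Lemma pssubst_ps2 n m F (a b : mps n A) (c : 'I_n -> mps m A) :
  a 0%MM = 0 -> b 0%MM = 0 -> (forall i, c i 0%MM = 0) ->
  pssubst (ps2 F a b) c = ps2 F (pssubst a c) (pssubst b c).
Proof.
move=> a0 b0 c0; rewrite /ps2 pssubstA //; last exact: tnth2_coef0.
by congr pssubst; apply/funext => -[[|[|//]] lt_i]; rewrite !(tnth_nth 0).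
Qed.

Lemma pscomp_ps2 n F (a b : mps n A) (f : mps 1 A) : a 0%MM = 0 -> b 0%MM = 0 ->
  F 0%MM = 0 -> pscomp f (ps2 F a b) = ps2 (pscomp f F) a b.
Proof.
by move=> a0 b0 F0; rewrite /ps2 pssubstA //; apply: tnth2_coef0.
Qed.

Lemma eqps_ps2 n d F (a a' b b' : mps n A) :
  a =_[d] a' -> b =_[d] b' -> ps2 F a b =_[d] ps2 F a' b'.
Proof.
by move=> aa' bb'; apply: eqps_substr => -[[|[|//]] lt_i];
  rewrite !(tnth_nth 0).
Qed.

Lemma pssubst_var2 n i (a b : mps n A) : a 0%MM = 0 -> b 0%MM = 0 ->
  (i < 2)%N ->
  pssubst (var2 A i) (tnth [tuple a; b]) = nth 0 [:: a; b] i.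
Proof.
move=> a0 b0 lt_i; rewrite pssubstX; last exact: tnth2_coef0.
by rewrite (tnth_nth 0) inordK.
Qed.

Lemma var2_coef0 i : var2 A i 0%MM = 0. Proof. exact: psX_eq0. Qed.

Definition ps_add2 : mps 2 A := var2 A 0 + var2 A 1.

Lemma ps2_add n (a b : mps n A) : a 0%MM = 0 -> b 0%MM = 0 ->
  ps2 ps_add2 a b = a + b.
Proof.
move=> a0 b0; rewrite /ps2 -[LHS]/(pseval (tnth2_coef0 a0 b0) _) raddfD /=.
by congr (_ + _); exact: pssubst_var2.
Qed.

(** [F] differs from x + y by a series of order [d], whose order becomes [e * d] once arguments of
    order [e] are substituted. *)
Lemma ps2_add_ord n d e F (a b : mps n A) : (0 < e)%N -> F =_[d] ps_add2 ->
  a =_[e] 0 -> b =_[e] 0 -> ps2 F a b =_[e * d] a + b.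
Proof.
move=> e_gt0 Fd a0 b0.
have a00 : a 0%MM = 0 by apply/eqps1; apply: (eqpsW a0).
have b00 : b 0%MM = 0 by apply/eqps1; apply: (eqpsW b0).
rewrite -(ps2_add a00 b00); apply/eqps_subr.
rewrite /ps2 -!/(pseval (tnth2_coef0 a00 b00) _) -raddfB.
by apply: pssubst_ord; [apply/eqps_subr | case=> [[|[|//]] lt_i];
  rewrite (tnth_nth 0)].
Qed.

End TwoVariables.

Lemma psmap_ps2 (A B : comNzRingType) (phi : {rmorphism A ->
  B}) n F (a b : mps n A) :
  psmap phi (ps2 F a b) = ps2 (psmap phi F) (psmap phi a) (psmap phi b).
Proof.
rewrite /ps2 psmap_subst; congr pssubst.
by apply/funext => -[[|[|//]] lt_i]; rewrite !(tnth_nth 0).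
Qed.

Lemma psmap_var2 (A B : comNzRingType) (phi : {rmorphism A -> B}) i :
  psmap phi (var2 A i) = var2 B i.
Proof. exact: psmapX. Qed.

Lemma psmap_var3 (A B : comNzRingType) (phi : {rmorphism A -> B}) i :
  psmap phi (var3 A i) = var3 B i.
Proof. exact: psmapX. Qed.

Lemma psmap_comp (A B : comNzRingType) (phi : {rmorphism A ->
  B}) n f (a : mps n A) :
  psmap phi (pscomp f a) = pscomp (psmap phi f) (psmap phi a).
Proof. exact: psmap_subst. Qed.

Lemma psmap_add2 (A B : comNzRingType) (phi : {rmorphism A -> B}) :
  psmap phi (ps_add2 A) = ps_add2 B.
Proof. by rewrite raddfD /= !psmap_var2. Qed.

Lemma psmap_fgl (A B : comNzRingType) (phi : {rmorphism A -> B}) F :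
  is_fgl F -> is_fgl (psmap phi F).
Proof.
case=> F0l F0r FC FA; split.
- by move/(congr1 (psmap phi)): F0l; rewrite psmap_ps2 raddf0 psmapX.
- by move/(congr1 (psmap phi)): F0r; rewrite psmap_ps2 raddf0 psmapX.
- by move/(congr1 (psmap phi)): FC; rewrite psmap_ps2 !psmap_var2.
- by move/(congr1 (psmap phi)): FA; rewrite !psmap_ps2 !psmap_var3.
Qed.

Lemma psmap_psum (A B : comNzRingType) (phi : {rmorphism A -> B}) F a n :
  psmap phi (fgl_psum F a n) =
  fgl_psum (psmap phi F) (fun i => psmap phi (a i)) n.
Proof. by elim: n => [|n IHn] /=; rewrite ?raddf0 // psmap_ps2 IHn. Qed.

Lemma psmap_mon (A B : comNzRingType) (phi : {rmorphism A -> B}) a d :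
  psmap phi (psmon a d) = psmon (phi a) d.
Proof. by rewrite /psmon rmorphM rmorphXn /= psmapC psmapX. Qed.

(** * Group laws on series and finite formal sums *)

Section FormalGroupLaw.
Variables (A : comNzRingType) (F : mps 2 A).
Hypothesis fglF : is_fgl F.
Local Notation "a +F b" := (ps2 F a b) (at level 50, left associativity).

Lemma fgl_coef0 : F 0%MM = 0.
Proof.
move/(congr1 (fun f : mps 1 A => f 0%MM)): (fgl_0l fglF).
by rewrite ps2_coef0 // psX_eq0.
Qed.

Lemma fgl_add_coef0 n (a b : mps n A) : a 0%MM = 0 -> b 0%MM = 0 ->
  (a +F b) 0%MM = 0.
Proof. by move=> a0 b0; rewrite ps2_coef0 // fgl_coef0. Qed.

Lemma pscomp0 n (a : mps n A) : a 0%MM = 0 -> pscomp (0 : mps 1 A) a = 0.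
Proof. by move=> a0; apply: mpsP => m; apply: big1 => k _; rewrite mul0r. Qed.

Lemma fgl_add0l n (a : mps n A) : a 0%MM = 0 -> 0 +F a = a.
Proof.
move=> a0; move/(congr1 (fun f => pscomp f a)): (fgl_0l fglF).
rewrite /pscomp pssubst_ps2 ?psX_eq0 // (pssubstX (fun=> a0)) => Fa.
by rewrite -[RHS]Fa; congr ps2; apply/esym/pscomp0.
Qed.

Lemma fgl_addC n (a b : mps n A) : a 0%MM = 0 -> b 0%MM = 0 -> a +F b = b +F a.
Proof.
move=> a0 b0; rewrite -{1}(fgl_C fglF) {1}/ps2 pssubst_ps2 ?var2_coef0 //.
  by rewrite !pssubst_var2.
exact: tnth2_coef0.
Qed.

Lemma fgl_add0r n (a : mps n A) : a 0%MM = 0 -> a +F 0 = a.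
Proof. by move=> a0; rewrite fgl_addC // fgl_add0l. Qed.

Lemma fgl_addA n (a b c : mps n A) : a 0%MM = 0 -> b 0%MM = 0 -> c 0%MM = 0 ->
  a +F (b +F c) = a +F b +F c.
Proof.
move=> a0 b0 c0; pose s := tnth [tuple a; b; c].
have s0 i : s i 0%MM = 0 by case: i => [[|[|[|//]]] lt_i];
  rewrite /s (tnth_nth 0).
have sE i : (i < 3)%N -> pssubst (var3 A i) s = nth 0 [:: a; b; c] i.
  by move=> lt_i; rewrite pssubstX // /s (tnth_nth 0) inordK.
have v0 i : var3 A i 0%MM = 0 by apply: psX_eq0.
move/(congr1 (fun f => pssubst f s)): (fgl_A fglF).
by rewrite !pssubst_ps2 ?fgl_add_coef0 // !sE.
Qed.

Lemma fgl_addACA n (a b c d : mps n A) :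
  a 0%MM = 0 -> b 0%MM = 0 -> c 0%MM = 0 -> d 0%MM = 0 ->
  (a +F b) +F (c +F d) = (a +F c) +F (b +F d).
Proof.
move=> a0 b0 c0 d0; rewrite -!fgl_addA ?fgl_add_coef0 //; congr (_ +F _).
by rewrite !fgl_addA // (fgl_addC b0).
Qed.

Section Sums.
Implicit Types a b : nat -> mps 1 A.
Local Notation S := (fgl_psum F).

Lemma psum_coef0 a n : (forall i, a i 0%MM = 0) -> S a n 0%MM = 0.
Proof. by move=> a0; elim: n => // n IHn; apply: fgl_add_coef0. Qed.

Lemma psum_subst a n (f : mps 1 A) : (forall i, a i 0%MM = 0) -> f 0%MM = 0 ->
  pscomp (S a n) f = S (fun i => pscomp (a i) f) n.
Proof.
move=> a0 f0; elim: n => [|n IHn] /=; first exact: pscomp0.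
by rewrite -IHn [LHS]pssubst_ps2 ?psum_coef0.
Qed.

Lemma eq_psum a b n : (forall i, (i < n)%N -> a i = b i) -> S a n = S b n.
Proof.
elim: n => //= n IHn ab; rewrite ab // IHn // => i lt_i.
by apply/ab/(leq_trans lt_i).
Qed.

Lemma psum_0 n : S (fun=> 0) n = 0.
Proof. by elim: n => //= n ->; rewrite fgl_add0l. Qed.

Lemma psum_add a b n : (forall i, a i 0%MM = 0) -> (forall i, b i 0%MM = 0) ->
  S (fun i => a i +F b i) n = S a n +F S b n.
Proof.
move=> a0 b0; elim: n => [|n IHn] /=; first by rewrite fgl_add0l.
by rewrite IHn fgl_addACA ?psum_coef0.
Qed.

Lemma psum_recl a n : (forall i, a i 0%MM = 0) ->
  S a n.+1 = a 0%N +F S (fun i => a i.+1) n.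
Proof.
move=> a0; elim: n => [|n IHn]; first by rewrite /= fgl_add0l // fgl_add0r.
by rewrite -[LHS]/(S a n.+1 +F a n.+1) IHn -fgl_addA ?psum_coef0.
Qed.

Lemma psum_exchange (a : nat -> nat -> mps 1 A) n m :
  (forall i j, a i j 0%MM = 0) ->
  S (fun i => S (a i) m) n = S (fun j => S (fun i => a i j) n) m.
Proof.
move=> a0; elim: m => [|m IHm] /=; first by rewrite psum_0.
rewrite psum_add ?IHm // => i; exact: psum_coef0.
Qed.

Lemma psum_trunc d n0 a n : (forall i, a i 0%MM = 0) ->
  (forall i, (n0 <= i)%N -> a i =_[d] 0) -> (n0 <= n)%N -> S a n =_[d] S a n0.
Proof.
move=> a0 ad; elim: n => [|n IHn]; first by rewrite leqn0 => /eqP ->.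
rewrite leq_eqVlt ltnS => /orP[/eqP -> //|le_n] /=.
apply: (eqps_trans (g := S a n +F 0)); first by apply: eqps_ps2 => //;
  apply: ad.
by rewrite fgl_add0r ?psum_coef0 //; apply: IHn.
Qed.

Lemma psum_ord d a n : (forall i, a i 0%MM = 0) ->
  (forall i, a i =_[d] 0) -> S a n =_[d] 0.
Proof. by move=> a0 ad; apply: (psum_trunc (n0 := 0)). Qed.

(** Partial sums keep order [e], so [ps2_add_ord] applies at every addition. The final comparison of
    coefficients rests on this. *)
Lemma psum_add_ord d e a n : (0 < e)%N -> (0 < d)%N -> F =_[d] ps_add2 A ->
  (forall i, a i =_[e] 0) -> S a n =_[e * d] \sum_(i < n) a i.
Proof.
move=> e_gt0 d_gt0 Fd ae.
have a0 i : a i 0%MM = 0 by apply/eqps1; apply: (eqpsW (ae i)).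
elim: n => [|n IHn] /=; first by rewrite big_ord0.
rewrite big_ord_recr /=; apply: (eqps_trans (g := S a n + a n)).
  by apply: ps2_add_ord => //; apply: psum_ord.
exact: eqpsD.
Qed.

End Sums.

(* Successive approximation: replacing b by -r +_F b doubles the order of the
   error r = b +_F a. *)
Lemma fgl_opp_mod n (a : mps n A) d : F =_[2] ps_add2 A -> a 0%MM = 0 ->
  exists2 b : mps n A, b 0%MM = 0 & b +F a =_[d.+1] 0.
Proof.
move=> F2 a0; elim: d => [|d [b b0 ba]].
  by exists 0 => //; apply/eqps1; rewrite fgl_add_coef0.
set r := b +F a in ba *; have r0 : r 0%MM = 0 by apply: fgl_add_coef0.
have nr0 : (- r) 0%MM = 0 by rewrite -[LHS]/(- r 0%MM) r0 oppr0.
exists (- r +F b); first exact: fgl_add_coef0.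
rewrite -fgl_addA //.
apply: (eqpsW (d := (d.+1 * 2)%N));
  last by rewrite muln2 -addnn addSnnS leq_addl.
rewrite -[X in _ =_[_] X](addNr r); apply: ps2_add_ord => //.
by rewrite -[0]oppr0; apply: eqpsN.
Qed.

(** Cancellation modulo degree [d] uses an inverse of [a] at that precision, supplied by
    [fgl_opp_mod]. *)
Lemma fgl_addI_mod n d (a b c : mps n A) : F =_[2] ps_add2 A ->
  a 0%MM = 0 -> b 0%MM = 0 -> c 0%MM = 0 ->
  a +F b =_[d] a +F c -> b =_[d] c.
Proof.
move=> F2 a0 b0 c0 abc; have [a' a'0 a'a] := fgl_opp_mod d F2 a0.
have step (e : mps n A) : e 0%MM = 0 -> a' +F (a +F e) =_[d] e.
  move=> e0; rewrite fgl_addA // -[X in _ =_[_] X](fgl_add0l e0).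
  by apply: eqps_ps2 => //; apply: (eqpsW a'a).
apply: eqps_trans (step c c0); apply: eqps_trans (eqps_sym (step b b0)) _.
exact: eqps_ps2.
Qed.

End FormalGroupLaw.

Section MapSums.
Variables (A B : comNzRingType) (phi : {rmorphism A -> B}) (F : mps 2 A).

Lemma psmap_series n :
  psmap phi (fgl_series F n) = fgl_series (psmap phi F) n.
Proof. by rewrite /fgl_series psmap_psum; apply: eq_psum => j _;
  apply: psmapX. Qed.

Lemma psmap_psum_mon (a : nat -> A) (d : nat -> nat) n :
  psmap phi (fgl_psum F (fun j => psmon (a j) (d j)) n) =
  fgl_psum (psmap phi F) (fun j => psmon (phi (a j)) (d j)) n.
Proof. by rewrite psmap_psum; apply: eq_psum => j _; apply: psmap_mon. Qed.

End MapSums.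

(** * Logarithms and p-series *)

Section Logarithm.
Variables (p : nat) (A : comNzRingType) (l : nat -> A).
Hypotheses (p_gt1 : (1 < p)%N) (l0 : l 0%N = 1).
Local Notation L := (log_series p l).

Lemma log_series_mod n : L =_[p ^ n] \sum_(i < n) psmon (l i) (p ^ i).
Proof.
move=> m lt_m; rewrite coef_sum.
have lt_i i : mdeg m = (p ^ i)%N -> (i < (mdeg m).+1)%N && (i < n)%N.
  move=> def_m; rewrite ltnS -(ltn_exp2l i n p_gt1) -def_m lt_m andbT def_m.
  exact/ltnW/ltn_expl.
rewrite (eq_bigr (fun i : 'I_n => if mdeg m == (p ^ i)%N then l i else 0));
  last first.
  by move=> i _; rewrite psmonE; case: eqP.
rewrite -[LHS]/(\sum_(i < (mdeg m).+1 | mdeg m == (p ^ i)%N) l i) -big_mkcond /=.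
(* Both sums are extended to a common index range before their conditions are compared. *)
rewrite (big_ord_widen_cond (maxn n (mdeg m).+1) (fun i =>
  mdeg m == (p ^ i)%N) l) ?leq_maxr //.
rewrite [RHS](big_ord_widen_cond (maxn n (mdeg m).+1) (fun i =>
  mdeg m == (p ^ i)%N) l) ?leq_maxl //.
apply: eq_bigl => i; case: eqP => //= def_m.
by have /andP[-> ->] := lt_i _ def_m.
Qed.

Lemma log_series_coef0 : L 0%MM = 0.
Proof. by rewrite (@log_series_mod 0) ?mdeg0 // big_ord0. Qed.

Lemma log_series_lin : L =_[2] psX1.
Proof.
apply: (eqps_trans (g := \sum_(i < 1) psmon (l i) (p ^ i))).
  by apply: eqpsW (@log_series_mod 1) _; rewrite expn1.
by rewrite big_ord1 l0 psmon1.
Qed.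

(** Write x = L - (L - x). The second series has order 2, so its value modulo degree d + 1 depends
    on the argument modulo degree [d] only, and induction applies. *)
Lemma log_inj n d (a b : mps n A) : a 0%MM = 0 -> b 0%MM = 0 ->
  pscomp L a =_[d] pscomp L b -> a =_[d] b.
Proof.
move=> a0 b0; elim: d => // d IHd Lab.
have ab : a =_[d] b by apply: IHd; apply: eqpsW Lab _.
rewrite -(pscompX a0) -(pscompX b0).
have -> : psX1 = L - (L - psX1) by rewrite subKr.
rewrite (pscompB L _ a) (pscompB L _ b); apply: eqpsB => //;
  apply: eqps_comp_succ => //.
by apply/eqps_subr/log_series_lin.
Qed.

Variable F : mps 2 A.
Hypothesis fglF : is_fgl F.
Hypothesis logF : pscomp L F = pscomp L (var2 A 0) + pscomp L (var2 A 1).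

Lemma log_add n (a b : mps n A) : a 0%MM = 0 -> b 0%MM = 0 ->
  pscomp L (ps2 F a b) = pscomp L a + pscomp L b.
Proof.
move=> a0 b0; rewrite pscomp_ps2 ?fgl_coef0 // logF /ps2.
have ab0 := tnth2_coef0 a0 b0.
rewrite -[LHS]/(pseval ab0 _) raddfD /= /pseval /pscomp.
by rewrite !pssubstA ?var2_coef0 // !pssubst_var2.
Qed.

Lemma log_psum (a : nat -> mps 1 A) n : (forall i, a i 0%MM = 0) ->
  pscomp L (fgl_psum F a n) = \sum_(i < n) pscomp L (a i).
Proof.
move=> a0; elim: n => [|n IHn].
  rewrite big_ord0; apply: eqpsP => d; rewrite -[d]muln1.
  by apply: pssubst_ord => //; apply/eqps1/log_series_coef0.
by rewrite big_ord_recr /= -IHn; apply: log_add => //; apply: psum_coef0.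
Qed.

(** Regrouping by m = i + j; the terms of the square outside the triangle have i + j >= n, hence
    order p^n. *)
Lemma sum_triangle (T : nat -> nat -> mps 1 A) n :
  (forall i j, T i j =_[p ^ (i + j)] 0) ->
  \sum_(m < n) \sum_(i < m.+1) T i (m - i)%N =_[p ^ n]
  \sum_(j < n) \sum_(i < n) T i j.
Proof.
move=> T0; pose E (m i j : nat) := if (i + j == m)%N then T i j else 0.
have -> : \sum_(m < n) \sum_(i < m.+1) T i (m - i)%N =
    \sum_(j < n) \sum_(i < n) \sum_(m < n) E m i j.
  under eq_bigr => m _.
    rewrite (big_ord_widen n (fun i => T i (m - i)%N)) // big_mkcond /=.
    have def_E (i : 'I_n) : (if (i < m.+1)%N then T i (m - i)%N else 0) =
      \sum_(j < n) E m i j.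
      rewrite /E; case: ltnP => [|lt_mi].
        rewrite ltnS => le_im;
          have lt_j : (m - i < n)%N by apply: leq_ltn_trans (leq_subr _ _) _.
        rewrite (bigD1 (Ordinal lt_j)) //= subnKC // eqxx big1 ?addr0 // =>
          j ne_j.
        case: eqP => // def_m; case/eqP: ne_j; apply: val_inj => /=.
        by rewrite -def_m addKn.
      rewrite big1 // => j _; case: eqP => // def_m.
      by move: lt_mi; rewrite -def_m ltnNge leq_addr.
    under eq_bigr => i _ do rewrite def_E.
    rewrite exchange_big; over.
  by rewrite /= exchange_big; apply: eq_bigr => j _; rewrite exchange_big.
apply: eqps_sum => j _; apply: eqps_sum => i _; rewrite /E.
have [lt_n|ge_n] := ltnP (i + j) n.
  rewrite (bigD1 (Ordinal lt_n)) //= eqxx big1 ?addr0 // => m ne_m.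
  by case: eqP => // def_m; case/eqP: ne_m; apply: val_inj.
rewrite big1 => [|m _]; last by rewrite gtn_eqF // (leq_trans _ ge_n).
by apply/eqps_sym/(eqpsW (@T0 i j)); rewrite leq_exp2l.
Qed.

(** The logarithm sends the left side to p L and the right side to the sum of the L(v_j x^(p^j)).
    Araki's relation equates the two, and [log_inj] removes the logarithm. *)
Lemma araki_pseries (v : nat -> A) :
  (forall n, p%:R * l n = \sum_(i < n.+1) l i * v (n - i)%N ^+ (p ^ i)) ->
  forall n, fgl_series F p =_[p ^ n]
            fgl_psum F (fun j => psmon (v j) (p ^ j)) n.
Proof.
move=> lE n; have p_gt0 := ltnW p_gt1.
have vm0 j : psmon (v j) (p ^ j) 0%MM =
  0 by rewrite psmon_coef0 // expn_gt0 p_gt0.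
have X0 (_ : nat) : (psX1 : mps 1 A) 0%MM = 0 by apply: psX_eq0.
apply: log_inj; try exact: psum_coef0.
rewrite !log_psum //; pose T i j := psmon (l i * v j ^+ (p ^ i)) (p ^ (i + j)).
apply: (eqps_trans (g := \sum_(m < n) psmon (p%:R * l m) (p ^ m))).
  rewrite pscompX1r sumr_const card_ord.
  have -> : \sum_(m < n) psmon (p%:R * l m) (p ^ m) =
     (\sum_(m < n) psmon (l m) (p ^ m)) *+ p.
    rewrite -sumrMnl; apply: eq_bigr => i _.
    by rewrite -psmonM rmorph_nat mulr_natl.
  rewrite -[L *+ p]mulr_natl -[in X in _ =_[_] X]mulr_natl.
  exact/eqpsM/log_series_mod.
(* Araki's relation splits p l_m into the terms l_i v_j^(p^i) with i + j = m. *)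
apply: (eqps_trans (g := \sum_(j < n) \sum_(i < n) T i j)).
  apply: eqps_trans (sum_triangle (T := T) _); last by move=> i j;
    apply: psmon_ord.
  suff -> : \sum_(m < n) psmon (p%:R * l m) (p ^ m) =
    \sum_(m < n) \sum_(i < m.+1) T i (m - i)%N by [].
  apply: eq_bigr => m _; rewrite lE /psmon rmorph_sum mulr_suml.
  by apply: eq_bigr => i _; rewrite /T subnKC // -ltnS.
apply: eqps_sum => j _; apply: eqps_sym.
apply: (eqps_trans (g := pscomp (\sum_(i < n) psmon (l i) (p ^ i)) (psmon (v j) (p ^ j)))).
  by apply: eqps_comp => //; apply: log_series_mod.
rewrite -[pscomp _ _]/(pseval (fun=> vm0 j) _) raddf_sum /=;
  apply: eqps_sum => i _.
by rewrite [pseval _ _]pscomp_mon // psmonX psmonM -expnD addnC.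
Qed.

End Logarithm.

(** * The p-series and the vanishing of Araki generators *)

Section PSeries.
Variables (p h : nat) (A : comNzRingType) (F : mps 2 A) (v : nat -> A).
Hypotheses (p_gt1 : (1 < p)%N) (h_gt0 : (0 < h)%N) (fglF : is_fgl F).
Hypothesis vF : forall n, fgl_series F p =_[p ^ n]
  fgl_psum F (fun j => psmon (v j) (p ^ j)) n.

Lemma psmon_p_coef0 a j : psmon a (p ^ j) 0%MM = 0 :> A.
Proof. by rewrite psmon_coef0 // expn_gt0 ltnW. Qed.

Lemma psmon_eqps_inj (a b : A) d e : (d < e)%N -> psmon a d =_[e] psmon b d ->
  a = b.
Proof.
move=> lt_de /(_ (U_(ord0) *+ d)%MM); rewrite !psmonE mdegMn mdeg1 mul1n eqxx.
exact.
Qed.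

Lemma pseries_two : (forall j, (j < h.-1)%N -> v j = 0) ->
  v h = 1 -> (forall j, (h < j)%N -> v j = 0) ->
  fgl_series F p =
  ps2 F (psmon (v h.-1) (p ^ h.-1)) (psmon 1 (p ^ h)).
Proof.
move=> v_lo vh v_hi; have m0 j := psmon_p_coef0 (v j) j.
(* The summand [d] makes the precision reach degree [d]; the summand [h.+1] ensures that the indices
   h - 1 and h occur in the formal sum. *)
apply: eqpsP => d; have le_d : (d <= p ^ (h.+1 + d))%N.
  by rewrite (leq_trans (ltnW (ltn_expl d p_gt1))) // leq_exp2l // leq_addl.
apply: eqps_trans (eqpsW (@vF (h.+1 + d)%N) le_d) _.
apply: eqps_trans (psum_trunc (n0 := h.+1) fglF m0 _ _) _.
- by move=> i lt_i; rewrite v_hi // psmon0.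
- by rewrite leq_addr.
rewrite -(prednK h_gt0) /= prednK // vh.
rewrite (eq_psum F (b := fun=> 0)) ?psum_0 ?fgl_add0l // => i lt_i.
by rewrite v_lo // psmon0.
Qed.

(** Once the earlier coefficients are gone, the series is v_j x^(p^j) modulo degree p^(j+1). Applied
    to the reduction of g_* F with [h.-1] for [h], this shows that g_* sends the generators of
    I_(h-1) into I_(h-1). *)
Lemma pseries_low : fgl_series F p =_[p ^ h] 0 -> forall j, (j < h)%N ->
  v j = 0.
Proof.
move=> F0; elim/ltn_ind => j IHj lt_j; have m0 i := psmon_p_coef0 (v i) i.
apply: (@psmon_eqps_inj _ _ (p ^ j) (p ^ j.+1)); first by rewrite ltn_exp2l.
rewrite psmon0; apply: (eqps_trans (g := fgl_series F p)); last first.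
  by apply: eqpsW F0 _; rewrite leq_exp2l.
apply: eqps_trans _ (eqps_sym (@vF j.+1)) => /=.
rewrite (eq_psum F (b := fun=> 0)) ?psum_0 ?fgl_add0l // => i lt_i.
by rewrite IHj ?psmon0 // (ltn_trans lt_i).
Qed.

End PSeries.

(** * Comparison of p-series *)

Section Homomorphism.
Variables (A : comNzRingType) (F F' : mps 2 A) (f : mps 1 A).
Hypotheses (fglF' : is_fgl F') (f0 : f 0%MM = 0).
Hypothesis fH : pscomp f F' = ps2 F (pscomp f (var2 A 0)) (pscomp f (var2 A 1)).

Lemma hom_add n (a b : mps n A) : a 0%MM = 0 -> b 0%MM = 0 ->
  pscomp f (ps2 F' a b) = ps2 F (pscomp f a) (pscomp f b).
Proof.
move=> a0 b0; have ab0 := tnth2_coef0 a0 b0.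
rewrite pscomp_ps2 ?fgl_coef0 //
  fH [LHS]pssubst_ps2 ?pscomp_coef0 ?var2_coef0 //.
by rewrite /pscomp !pssubstA ?var2_coef0 // !pssubst_var2.
Qed.

Lemma hom_psum (a : nat -> mps 1 A) n : (forall i, a i 0%MM = 0) ->
  pscomp f (fgl_psum F' a n) = fgl_psum F (fun i => pscomp f (a i)) n.
Proof.
move=> a0; elim: n => [|n IHn] /=.
  apply: eqpsP => d; rewrite -[d]muln1.
  by apply: pssubst_ord => //; apply/eqps1.
by rewrite -IHn hom_add // psum_coef0.
Qed.

Lemma hom_series n : pscomp f (fgl_series F' n) = fgl_psum F (fun=> f) n.
Proof.
rewrite hom_psum => [|_]; last exact: psX_eq0.
by apply: eq_psum => i _; apply: pscompX1r.
Qed.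

End Homomorphism.

Lemma series_comp (A : comNzRingType) (F : mps 2 A) (f : mps 1 A) n :
  is_fgl F -> f 0%MM = 0 ->
  pscomp (fgl_series F n) f = fgl_psum F (fun=> f) n.
Proof.
move=> fglF f0; rewrite psum_subst //.
by apply: eq_psum => i _; apply: pscompX.
Qed.

Lemma sum_psmon_coef (A : comNzRingType) p (c e : nat -> nat) (a : nat ->
  A) n i :
  (1 < p)%N -> (forall j, c j = (p ^ e j)%N) -> injective e -> (i < n)%N ->
  (\sum_(j < n) psmon (a j) (c j)) (U_(ord0) *+ c i)%MM = a i.
Proof.
move=> p_gt1 cE e_inj lt_i; rewrite coef_sum (bigD1 (Ordinal lt_i)) //.
rewrite big1 => [|j ne_j];
  first by rewrite [LHS]addr0 psmonE mdegMn mdeg1 mul1n eqxx.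
rewrite psmonE mdegMn mdeg1 mul1n; case: eqP => // /eqP.
rewrite !cE eqn_exp2l // => /eqP/e_inj def_i.
by case/eqP: ne_j; apply: val_inj.
Qed.

(** * The recursion over a ring in the role of R / I_(h-1), with [F'] for g_* F and [f] for h_g *)

Section Comparison.
Variables (p h : nat) (A : comNzRingType) (F F' : mps 2 A) (f f' : mps 1 A).
Variables (t v w : nat -> A).
Hypotheses (p_gt1 : (1 < p)%N) (h_gt1 : (1 < h)%N).
Hypotheses (fglF : is_fgl F) (fglF' : is_fgl F').
Hypothesis F_add : F =_[p ^ h.-1] ps_add2 A.
Hypotheses (f0 : f 0%MM = 0) (f'0 : f' 0%MM = 0) (f'f : pscomp f' f = psX1).
Hypothesis fH : pscomp f F' = ps2 F (pscomp f (var2 A 0)) (pscomp f (var2 A 1)).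
Hypothesis fE : forall n,
  f =_[p ^ n] fgl_psum F (fun i => psmon (t i) (p ^ i)) n.
Hypothesis vF : forall n,
  fgl_series F p =_[p ^ n] fgl_psum F (fun j => psmon (v j) (p ^ j)) n.
Hypothesis wF' : forall n,
  fgl_series F' p =_[p ^ n] fgl_psum F' (fun j => psmon (w j) (p ^ j)) n.
Hypothesis v_lo : forall j, (j < h.-1)%N -> v j = 0.
Hypotheses (vh : v h = 1) (v_hi : forall j, (h < j)%N -> v j = 0).
Hypotheses (wh : w h = 1) (w_hi : forall j, (h < j)%N -> w j = 0).

Local Notation q := (p ^ h.-1)%N.
Local Notation u := (v h.-1).
Local Notation w_ := (w h.-1).
Local Notation "a +F b" := (ps2 F a b) (at level 50, left associativity).

Let h_gt0 : (0 < h)%N. Proof. exact: ltnW. Qed.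
Let q_gt1 : (1 < q)%N.
Proof. by rewrite -(expn0 p) ltn_exp2l // -ltnS prednK. Qed.
Let mon0 a j : psmon a (p ^ j) 0%MM = 0 :> A.
Proof. exact: psmon_p_coef0. Qed.

Let pF : fgl_series F p = psmon u q +F psmon 1 (p ^ h).
Proof. exact: pseries_two. Qed.

Let pF_ord : fgl_series F p =_[q] 0.
Proof.
rewrite pF -(fgl_add0l fglF (a := 0 : mps 1 A)) //; apply: eqps_ps2.
  exact: psmon_ord.
by apply: eqpsW (@psmon_ord _ _ _) _; rewrite leq_exp2l // leq_pred.
Qed.

Let fp : pscomp f (fgl_series F' p) = pscomp (fgl_series F p) f.
Proof. by rewrite (hom_series fglF' f0 fH) series_comp. Qed.

(** The p-series of [F'] is f'([p]_F(f(x))), and composing with series without constant term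
    preserves the order of [p]_F. *)
Let pF'_ord : fgl_series F' p =_[q] 0.
Proof.
have p0 : fgl_series F' p 0%MM = 0 by apply: psum_coef0 => // _; exact: psX_eq0.
rewrite -(pscompX p0) -f'f pscompA // fp -[q]muln1.
apply: pssubst_ord; first exact/eqps1.
by move=> _; rewrite -[q]mul1n; apply: pssubst_ord => // _; apply/eqps1.
Qed.

Let pF' : fgl_series F' p = ps2 F' (psmon w_ q) (psmon 1 (p ^ h)).
Proof. by apply: pseries_two => //; apply: pseries_low pF'_ord. Qed.

(** The linear coefficient of [f] is t_0, so the linear term of f'(f(x)) = x makes that of [f'] its
    inverse. *)
Lemma lead_unit : exists s, s * t 0%N = 1.
Proof.
exists (f' U_(ord0)%MM); apply: (@psmon_eqps_inj _ _ _ 1 2) => //.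
rewrite psmon1 -f'f -psmonM -[psmon (t 0%N) 1]expr1 -pscomp_mon ?mon0 //;
  last first.
  exact: psmon_coef0.
apply: eqps_sym; apply: eqps_comp.
  move=> m; rewrite psmonE; case: (posnP (mdeg m)) => [/eqP|m_gt0 m_lt].
    by rewrite mdeg_eq0 => /eqP -> _; rewrite mdeg0.
  have m1 : mdeg m = 1%N by apply/eqP; rewrite eqn_leq -ltnS m_lt.
  by rewrite m1 eqxx; congr pscoef; apply: mdeg_inj1; rewrite m1 mdeg1.
apply: (eqpsW (d := p ^ 1)); last by rewrite expn1.
apply: eqps_trans (fE (n := 1)) _ => /=.
by rewrite fgl_add0l // expn0.
Qed.

Let T (j : nat) (c : A) := psmon c (p ^ (h + j)).

(** The identity h_g([p]_(g_* F)(x)) = [p]_F(h_g(x)), with h_g cut off after n + 1 terms. Setting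
    the leading terms in x^q apart leaves [n] terms in the sums over t_(j+1). *)
Let eq_main n :
  (psmon (t 0%N * w_) q +F fgl_psum F (fun j =>
    T j (t j.+1 * w_ ^+ (p ^ j.+1))) n)
    +F fgl_psum F (fun j => T j (t j)) n.+1
  =_[p ^ n.+1]
  (psmon (u * t 0%N ^+ q) q +F fgl_psum F (fun j => T j (u * t j.+1 ^+ q)) n)
    +F fgl_psum F (fun j => T j (t j ^+ (p ^ h))) n.+1.
Proof.
set Hn := fgl_psum F (fun i => psmon (t i) (p ^ i)) n.+1.
have Hn0 : Hn 0%MM = 0 by apply: psum_coef0.
have fHn : f =_[p ^ n.+1] Hn := fE (n := n.+1).
have HnT c d : (0 < d)%N -> pscomp Hn (psmon c d) =
    fgl_psum F (fun j => psmon (t j * c ^+ (p ^ j)) (d * p ^ j)) n.+1.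
  move=> d_gt0; have c0 := psmon_coef0 c d_gt0.
  rewrite psum_subst //; apply: eq_psum => j _.
  by rewrite pscomp_mon // psmonX psmonM.
have q_gt0 := ltnW q_gt1; have ph_gt0 : (0 < p ^ h)%N by rewrite expn_gt0 ltnW.
(* Index 0 gives the leading term; index j + 1 has exponent p^(h-1) p^(j+1) = p^(h+j). *)
have -> : psmon (t 0%N * w_) q +F
    fgl_psum F (fun j => T j (t j.+1 * w_ ^+ (p ^ j.+1))) n =
    pscomp Hn (psmon w_ q).
  rewrite HnT // psum_recl // => [|j]; last by rewrite -expnD mon0.
  rewrite expn0 expr1 muln1; congr (_ +F _); apply: eq_psum => j _.
  by rewrite /T -expnD addnS -addSn prednK.
have -> : fgl_psum F (fun j => T j (t j)) n.+1 = pscomp Hn (psmon 1 (p ^ h)).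
  rewrite HnT //; apply: eq_psum => j _.
  by rewrite /T expr1n mulr1 expnD.
have -> : psmon (u * t 0%N ^+ q) q +F
    fgl_psum F (fun j => T j (u * t j.+1 ^+ q)) n =
    fgl_psum F (fun j => psmon (u * t j ^+ q) (p ^ j * q)) n.+1.
  rewrite psum_recl // => [|j]; last by rewrite -expnD mon0.
  rewrite expn0 mul1n; congr (_ +F _); apply: eq_psum => j _.
  by rewrite /T -expnD addSn -addnS prednK // addnC.
have -> : fgl_psum F (fun j => T j (t j ^+ (p ^ h))) n.+1 =
    fgl_psum F (fun j => psmon (t j ^+ (p ^ h)) (p ^ j * p ^ h)) n.+1.
  by apply: eq_psum => j _; rewrite /T expnD mulnC.
rewrite -psum_add // => [|j|j]; try by rewrite -expnD mon0.
have -> : fgl_psum F (fun j => psmon (u * t j ^+ q) (p ^ j * q) +F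
      psmon (t j ^+ (p ^ h)) (p ^ j * p ^ h)) n.+1 =
    pscomp (fgl_series F p) Hn.
  (* Exchanging the p-fold sum with the sum over j applies [p]_F to each monomial t_j x^(p^j)
     separately. *)
  rewrite series_comp // /Hn psum_exchange //; apply: eq_psum => j _.
  rewrite -series_comp // pF [RHS]pssubst_ps2 ?mon0 //.
  rewrite [pssubst _ _]pscomp_mon // [pssubst _ _]pscomp_mon //.
  by rewrite !psmonX !psmonM mul1r.
apply: (eqps_trans (g := pscomp f (fgl_series F' p))); last first.
  by rewrite fp; apply: eqps_comp.
rewrite pF' (hom_add fglF' f0 fH) ?mon0 //.
by apply/eqps_sym/eqps_ps2; apply: eqps_comp.
Qed.

Theorem stabilizer_recursion i : (i < h.-1)%N ->
  t i + t i.+1 * (u * t 0%N ^+ q.-1) ^+ (p ^ i.+1) =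
  t i ^+ (p ^ h) + u * t i.+1 ^+ q.
Proof.
move=> lt_i; have q_gt0 := ltnW q_gt1.
have n_gt0 : (0 < h + h.-1)%N by rewrite addn_gt0 h_gt0.
have T_ord j c : T j c =_[p ^ h] 0.
  by apply: eqpsW (@psmon_ord _ _ _) _; rewrite leq_exp2l // leq_addr.
have T0 j c : T j c 0%MM = 0 by apply: mon0.
(* This [n] makes the precision p^(n+1) equal to p^h q, the bound up to which formal sums of order
   p^h are ordinary. *)
pose n := (h + h.-1).-1; have def_n : n.+1 = (h + h.-1)%N by rewrite prednK.
move: (@eq_main n); rewrite -!fgl_addA ?psum_coef0 //.
set X := (fgl_psum _ _ _ +F _);
  set Y := (fgl_psum F (fun j => T j (u * _)) n +F _).
have X0 : X 0%MM = 0 by apply: fgl_add_coef0 => //; apply: psum_coef0.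
have Y0 : Y 0%MM = 0 by apply: fgl_add_coef0 => //; apply: psum_coef0.
have X_ord : X =_[p ^ h] 0.
  by rewrite -(fgl_add0l fglF (a := 0 : mps 1 A)) //; apply: eqps_ps2;
    apply: psum_ord.
have Y_ord : Y =_[p ^ h] 0.
  by rewrite -(fgl_add0l fglF (a := 0 : mps 1 A)) //; apply: eqps_ps2;
    apply: psum_ord.
(* Modulo degree p^h the remainders X and Y vanish, and only the coefficients of x^q are
   compared. *)
move=> eqXY; have tw : t 0%N * w_ = u * t 0%N ^+ q.
  apply: (@psmon_eqps_inj _ _ _ q (p ^ h));
    first by rewrite ltn_exp2l // ltn_predL.
  rewrite -(fgl_add0r fglF (mon0 (t 0%N * w_) h.-1)).
  rewrite -(fgl_add0r fglF (mon0 (u * t 0%N ^+ q) h.-1)).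
  apply: (eqps_trans (g := psmon (t 0%N * w_) q +F X)).
    by apply: eqps_ps2 => //; apply: eqps_sym.
  apply: (eqps_trans (g := psmon (u * t 0%N ^+ q) q +F Y)).
    by apply: eqpsW eqXY _; rewrite leq_exp2l // def_n leq_addr.
  exact: eqps_ps2.
have def_w : w_ = u * t 0%N ^+ q.-1.
  have [s st] := lead_unit; rewrite -[LHS]mul1r -st -mulrA tw.
  by rewrite -[in LHS](prednK q_gt0) exprS mulrCA (mulrA s) st mul1r.
have F2 : F =_[2] ps_add2 A by apply: eqpsW F_add _.
have {}eqXY : X =_[p ^ n.+1] Y.
  by move: eqXY; rewrite tw; apply: fgl_addI_mod.
have ph_gt0 : (0 < p ^ h)%N by rewrite expn_gt0 ltnW.
have sumF (a b : nat -> A) : fgl_psum F (fun j => T j (a j)) n +F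
    fgl_psum F (fun j => T j (b j)) n.+1 =_[p ^ n.+1]
    \sum_(j < n) T j (a j) + \sum_(j < n.+1) T j (b j).
  have -> : (p ^ n.+1 = p ^ h * q)%N by rewrite def_n expnD.
  apply: (eqps_trans (g := fgl_psum F (fun j => T j (a j)) n +
                           fgl_psum F (fun j => T j (b j)) n.+1)).
    by apply: ps2_add_ord => //; apply: psum_ord.
  apply: eqpsD.
    exact: (psum_add_ord fglF n ph_gt0 q_gt0 F_add (fun j => T_ord j (a j))).
  exact: (psum_add_ord fglF n.+1 ph_gt0 q_gt0 F_add (fun j => T_ord j (b j))).
have lt_in : (i < n)%N.
  by rewrite -ltnS def_n (leq_ltn_trans lt_i) //
    -[X in (X < _)%N]add0n ltn_add2r.
have coefT (a : nat -> A) m : (i < m)%N ->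
    (\sum_(j < m) T j (a j)) (U_(ord0) *+ p ^ (h + i))%MM = a i.
  move=> lt_im.
  by apply: (@sum_psmon_coef A p (fun j => p ^ (h + j))%N (addn h)) =>
    // x y /addnI.
have eq_sum := eqps_trans (eqps_sym (@sumF _ _)) (eqps_trans eqXY (@sumF _ _)).
(* The bound i < h - 1 amounts to h + i < 2h - 1, which puts degree p^(h+i) in the additive
   range. *)
have lt_deg : (mdeg (U_(ord0 : 'I_1) *+ p ^ (h + i))%MM < p ^ n.+1)%N.
  by rewrite mdegMn mdeg1 mul1n ltn_exp2l // def_n ltn_add2l.
have := eq_sum _ lt_deg; rewrite -[LHS]/(pscoef _ _ + pscoef _ _).
rewrite -[RHS]/(pscoef _ _ + pscoef _ _).
have lt_iSn := ltnW lt_in.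
rewrite (coefT (fun j => t j.+1 * w_ ^+ (p ^ j.+1)) n) // (coefT t n.+1) //.
rewrite (coefT (fun j => u * t j.+1 ^+ q) n) // (coefT (fun j =>
  t j ^+ (p ^ h)) n.+1) //.
by rewrite def_w addrC => ->; rewrite addrC.
Qed.

End Comparison.

(** * Reduction of the universal p-typical formal group law *)

Section IdealQuotient.
Variables (A : comNzRingType) (n : nat) (x : nat -> A).
Hypothesis proper : ~ ideal_gen n x 1.

(** [idealr_closed] demands that 1 lie outside; taking properness as an argument allows a canonical
    ideal structure. *)
Definition gen_pred of ~ ideal_gen n x 1 : {pred A} := fun a =>
  `[< ideal_gen n x a >].

Fact gen_pred_closed : idealr_closed (gen_pred proper).
Proof.
split=> [||a b c].
- by apply/asboolP; exists (fun=> 0); rewrite big1 // => i _; rewrite mul0r.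
- exact/asboolPn.
move=> /asboolP[cb ->] /asboolP[cc ->]; apply/asboolP.
exists (fun i => a * cb i + cc i); rewrite mulr_sumr -big_split /=.
by apply: eq_bigr => i _; rewrite mulrDl mulrA.
Qed.
HB.instance Definition _ := isIdealr.Build A (gen_pred proper) gen_pred_closed.

Lemma ideal_gen_quotient : exists (B : comNzRingType) (pi : {rmorphism A -> B}),
  forall a, pi a = 0 <-> ideal_gen n x a.
Proof.
pose pi : {rmorphism A -> {ideal_quot (gen_pred proper)}} :=
  \pi_{ideal_quot (gen_pred proper)}%qT.
exists {ideal_quot (gen_pred proper)}, pi => a.
apply: (iff_trans (B := a \in gen_pred proper)); last by split=> /asboolP.
rewrite -[a in X in _ <-> X]subr0 Quotient.idealrBE -(rmorph0 pi).
by split=> [/eqP|/eqP].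
Qed.

End IdealQuotient.

(** * Integral and rational forms of the universal law *)

Section Universal.
Variable p : nat.
Local Notation V := (ptypV p).
Local Notation VQ := ptypVQ.

(** [plocal_alg] and [cm_malg] name the two functions inside [ptypV_to_Q], so that they can carry
    morphism structures; [ptypV_Q] is convertible to [ptypV_to_Q]. *)
Definition plocal_alg (c : plocal p) : VQ := (plocal_val c)%:A.
Definition cm_malg (m : {cmonom nat}) : VQ := << m >>.

Fact plocal_alg_zmod : zmod_morphism plocal_alg.
Proof. by move=> a b; rewrite /plocal_alg -scalerBl. Qed.
Fact plocal_alg_monoid : monoid_morphism plocal_alg.
Proof.
by split=> [|a b]; rewrite /plocal_alg ?scale1r // -scalerAl mul1r scalerA.
Qed.
HB.instance Definition _ :=
  GRing.isZmodMorphism.Build (plocal p) VQ plocal_alg plocal_alg_zmod.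
HB.instance Definition _ :=
  GRing.isMonoidMorphism.Build (plocal p) VQ plocal_alg plocal_alg_monoid.

Fact cm_malg_mmorphism : mmorphism cm_malg.
Proof.
by split=> // k1 k2; rewrite /cm_malg [RHS]malgM_def fgmulUU mulr1.
Qed.
HB.instance Definition _ := isMultiplicative.Build _ VQ cm_malg cm_malg_mmorphism.

Definition ptypV_Q : {rmorphism V -> VQ} := monalg.mmap plocal_alg cm_malg.

Lemma coef_ptypV_Q (y : V) k :
  monalg.mcoeff k (ptypV_Q y : {malg rat[{cmonom nat}]}) =
  plocal_val (monalg.mcoeff k (y : {malg (plocal p)[{cmonom nat}]})).
Proof.
rewrite -[ptypV_Q y]/(monalg.mmap plocal_alg cm_malg y) monalg.mmapE raddf_sum /=.
under eq_bigr => k' _ do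
  rewrite /plocal_alg /cm_malg -scalerAl mul1r monalg.mcoeffZ mcoeffU1.
have [k_in|k_notin] := boolP (k \in monalg.msupp (y : {malg (plocal p)[{cmonom nat}]})).
  rewrite (bigD1_seq k) //= eqxx mulr1 big1 ?addr0 // => k' /negbTE ->.
  by rewrite mulr0.
rewrite monalg.mcoeff_outdom // big_seq big1 // => k' k'_in.
by case: eqP k_notin => [<-|]; rewrite ?k'_in ?mulr0.
Qed.

Lemma ptypV_Q_inj : injective ptypV_Q.
Proof.
move=> y z eq_yz; apply/malgP => k; apply: val_inj.
by rewrite -[LHS]coef_ptypV_Q eq_yz -[RHS]coef_ptypV_Q.
Qed.

Lemma ptypV_Q_araki j : ptypV_Q (araki p j.+1) =
  << ucm j >> :> {malg rat[{cmonom nat}]}.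
Proof.
rewrite -[LHS]/(monalg.mmap plocal_alg cm_malg << ucm j >>) mmapU.
by rewrite [X in X * _]plocal_alg_monoid.1 mul1r.
Qed.

Lemma coef_mul_ucm (c : {malg rat[{cmonom nat}]}) j (k : {cmonom nat}) :
  monalg.mcoeff k (c * << ucm j >>) != 0 -> exists k', k = mulcm k' (ucm j).
Proof.
apply: contra_neqP => no_k; rewrite malgM_def fgmulgU raddf_sum big1 // => k' _.
rewrite /= monalg.mcoeffU; case: eqP => // def_k.
by case: no_k; exists k'.
Qed.

Lemma malgU_mulcm (A : comNzRingType) (a : A) (k k' : {cmonom nat}) :
  << a *g mulcm k k' >> = << a *g k >> * << k' >> :> {malg A[{cmonom nat}]}.
Proof. by rewrite malgM_def fgmulUU mulr1. Qed.

Lemma mkmalgU_araki (a : plocal p) (k : {cmonom nat}) j :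
  << a *g mulcm k (ucm j) >> = (<< a *g k >> : V) * araki p j.+1 :> V.
Proof. exact: malgU_mulcm. Qed.

Lemma morph_mkmalgU_araki (B : comNzRingType) (psi : {rmorphism V -> B})
    (a : plocal p) (k k' : {cmonom nat}) j :
  psi (araki p j.+1) = 0 -> k = mulcm k' (ucm j) -> psi (<< a *g k >> : V) = 0.
Proof.
move=> psi0 ->; rewrite (congr1 psi (mkmalgU_araki a k' j)) (rmorphM psi).
by rewrite [X in _ * X]psi0 mulr0.
Qed.

(** The ideal (v_1, ..., v_n) is monomial: every monomial occurring in [y] is divisible by one of
    these variables, so [psi] kills each term of [y] with its p-local coefficient. Membership over Q
    thus descends to V. *)
Lemma ideal_araki_Q n (B : comNzRingType) (psi : {rmorphism V -> B}) (y : V) :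
  (forall j, (j < n)%N -> psi (araki p j.+1) = 0) ->
  ideal_gen n (fun j => ptypV_Q (araki p j.+1)) (ptypV_Q y) -> psi y = 0.
Proof.
move=> psi0 [c def_y].
rewrite [y](monalgE (y : {malg (plocal p)[{cmonom nat}]})) rmorph_sum.
rewrite big_seq big1 // => k k_in.
set a := monalg.mcoeff k _.
have nz_k : monalg.mcoeff k (ptypV_Q y : {malg rat[{cmonom nat}]}) != 0.
  rewrite coef_ptypV_Q; apply: contraTneq k_in => y0.
  by rewrite -monalg.mcoeff_eq0; apply/eqP/val_inj.
have [j [lt_j [k' def_k]]] : exists j, (j < n)%N /\ exists k', k =
  mulcm k' (ucm j).
  apply: contrapT => no_j; case/eqP: nz_k;
    rewrite def_y raddf_sum big1 // => j _.
  apply: contra_notP no_j => /eqP nz_j; exists j; split=> //.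
  by apply: (coef_mul_ucm (c := c j)); rewrite -ptypV_Q_araki.
exact: (morph_mkmalgU_araki _ (psi0 j lt_j) def_k).
Qed.

Lemma proper_araki_Q n : ~ ideal_gen n (fun j => ptypV_Q (araki p j.+1)) 1.
Proof.
case=> c def_1; have : monalg.mcoeff (onecm nat) (1 : {malg rat[{cmonom nat}]}) != 0.
  by rewrite monalg.mcoeff1 eqxx oner_eq0.
rewrite [X in monalg.mcoeff _ X]def_1 raddf_sum big1 ?eqxx // => j _.
apply/eqP; rewrite ptypV_Q_araki; apply/negPn/negP => /coef_mul_ucm[k'] /eqP.
by rewrite eq_sym cmM_eq1 cm1_eq1 andbF.
Qed.

Lemma psmap_log (A B : comNzRingType) (phi : {rmorphism A -> B}) l :
  psmap phi (log_series p l) = log_series p (phi \o l).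
Proof. by apply: mpsP => m /=; rewrite rmorph_sum. Qed.

Hypothesis p_pr : prime p.
Let p_gt1 : (1 < p)%N. Proof. exact: prime_gt1. Qed.

Variable G : mps 2 V.
Hypothesis univG : is_universal_ptypical G.

(** The formula is proved over the rationalization, where the logarithm lives, descends to V by
    injectivity, and is then pushed forward. *)
Lemma universal_pseries (A : comNzRingType) (psi : {rmorphism V -> A}) n :
  fgl_series (psmap psi G) p =_[p ^ n]
  fgl_psum (psmap psi G) (fun j => psmon (psi (araki p j)) (p ^ j)) n.
Proof.
have [fglG [l [l0 lE] logG]] := univG.
have GE : fgl_series G p =_[p ^ n] fgl_psum G (fun j =>
  psmon (araki p j) (p ^ j)) n.
  have vQ := @araki_pseries p VQ l p_gt1 l0 (psmap ptypV_Q G)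
    (psmap_fgl ptypV_Q fglG) logG (fun j => ptypV_Q (araki p j)) lE n.
  move=> m lt_m; apply: ptypV_Q_inj.
  have := vQ m lt_m; rewrite -psmap_series.
  by rewrite -(psmap_psum_mon ptypV_Q G (araki p) (expn p)).
have := eqps_map psi GE.
by rewrite psmap_series (psmap_psum_mon psi G (araki p) (expn p)).
Qed.

(** Araki's relation reads (p - p^(p^m)) l_m = sum of l_i v_(m-i)^(p^i) over i < m. The term i = 0
    contains v_m = 0, the others an l_i that vanishes by induction. *)
Lemma araki_log_vanish (B : comNzRingType) (l v : nat -> B) n :
  (forall m, (0 < m)%N -> exists c : B, c * (p%:R - p%:R ^+ (p ^ m)) = 1) ->
  l 0%N = 1 ->
  (forall m, p%:R * l m = \sum_(i < m.+1) l i * v (m - i)%N ^+ (p ^ i)) ->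
  v 0%N = p%:R -> (forall j, (0 < j <= n)%N -> v j = 0) ->
  forall j, (0 < j <= n)%N -> l j = 0.
Proof.
move=> p_inv l0 lE v0 v_lo; elim/ltn_ind => -[//|j] IHj le_jn.
have [c cp] := p_inv j.+1 isT.
rewrite -[LHS]mul1r -cp -mulrA mulrBl lE big_ord_recr /= subnn v0.
rewrite [l _ * _]mulrC addrK big_ord_recl /= subn0 v_lo // expr0n expn_eq0.
rewrite eqn0Ngt (ltnW p_gt1) /= mulr0 add0r big1 ?mulr0 // => i _.
rewrite IHj ?mul0r //= /bump add1n ?ltnS //.
by rewrite (leq_trans (ltn_ord i)) // ltnW.
Qed.

(** Once v_1, ..., v_n vanish, the logarithm is x modulo degree p^(n+1), so the law it linearizes is
    x + y to that order. *)
Lemma universal_add_Q (B : comNzRingType) (pi : {rmorphism VQ -> B}) n :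
  (forall j, (j < n)%N -> pi (ptypV_Q (araki p j.+1)) = 0) ->
  psmap pi (psmap ptypV_Q G) =_[p ^ n.+1] ps_add2 B.
Proof.
move=> pi0; have [fglG [l [l0 lE] logG]] := univG.
pose v j := ptypV_Q (araki p j).
have {}lE m : p%:R * l m = \sum_(i < m.+1) l i * v (m - i)%N ^+ (p ^ i) := lE m.
have v0 : v 0%N = p%:R := rmorph_nat ptypV_Q p.
have {}pi0 j : (0 < j <= n)%N -> pi (v j) = 0 by case: j => // j /pi0.
have {}logG : pscomp (log_series p l) (psmap ptypV_Q G) =
  pscomp (log_series p l) (var2 VQ 0) + pscomp (log_series p l) (var2 VQ 1) := logG.
have pil0 : pi (l 0%N) = 1 by rewrite l0 rmorph1.
(* For m > 0 this is a nonzero rational, invertible in [B] through the Q-algebra [VQ]. *)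
have p_inv m : (0 < m)%N -> exists c : B, c * (p%:R - p%:R ^+ (p ^ m)) = 1.
  move=> m_gt0; pose r : rat := p%:R - p%:R ^+ (p ^ m).
  have nz_r : r != 0.
    rewrite subr_eq0 -natrX Num.Theory.eqr_nat -{1}[p]expn1 eqn_exp2l //.
    by rewrite -{1}(expn0 p) eqn_exp2l // ltn_eqF.
  exists (pi (in_alg VQ r^-1)).
  have -> : p%:R - p%:R ^+ (p ^ m) = pi (in_alg VQ r).
    by rewrite /r !(rmorphB, rmorphXn) !rmorph_nat.
  by rewrite -!rmorphM mulVf // !rmorph1.
have pilE m : p%:R * (pi \o l) m =
    \sum_(i < m.+1) (pi \o l) i * (pi \o v) (m - i)%N ^+ (p ^ i).
  rewrite /= -{1}(rmorph_nat pi) -rmorphM lE rmorph_sum.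
  by apply: eq_bigr => i _; rewrite rmorphM rmorphXn.
have piv0 : (pi \o v) 0%N = p%:R by rewrite /= v0 rmorph_nat.
have pil := araki_log_vanish p_inv pil0 pilE piv0 pi0.
have logX : log_series p (pi \o l) =_[p ^ n.+1] psX1.
  apply: eqps_trans (@log_series_mod p B (pi \o l) p_gt1 n.+1) _.
  rewrite big_ord_recl /= pil0 expn0 psmon1 big1 ?addr0 // => i _.
  by rewrite [pi _]pil ?psmon0 // /bump add1n ltn_ord.
have GX : psmap pi (psmap ptypV_Q G) =_[p ^ n.+1]
    pscomp (log_series p (pi \o l)) (psmap pi (psmap ptypV_Q G)).
  rewrite -{1}[psmap pi _]pscompX; first by apply: eqps_comp => //;
    apply: eqps_sym.
  by apply/fgl_coef0/psmap_fgl/psmap_fgl.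
have varX i : pscomp (log_series p (pi \o l)) (var2 B i) =_[p ^ n.+1] var2 B i.
  by rewrite -[X in _ =_[_] X]pscompX ?var2_coef0 //; apply: eqps_comp.
apply: eqps_trans GX _; rewrite -psmap_log -psmap_comp logG raddfD /=.
by apply: eqpsD; rewrite psmap_comp psmap_log [psmap pi (var2 _ _)]psmap_var2.
Qed.

(** [B] may have characteristic p and carry no logarithm. The congruence is checked in the quotient
    of the rationalized ring by (v_1, ..., v_n), and [ideal_araki_Q] transfers it to [psi]. *)
Lemma universal_add (B : comNzRingType) (psi : {rmorphism V -> B}) n :
  (forall j, (j < n)%N -> psi (araki p j.+1) = 0) ->
  psmap psi G =_[p ^ n.+1] ps_add2 B.
Proof.
move=> psi0; have [C [pi piP]] := ideal_gen_quotient (@proper_araki_Q n).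
have pi0 j : (j < n)%N -> pi (ptypV_Q (araki p j.+1)) = 0.
  move=> lt_j; apply/piP; exists (fun i => (i == j)%:R).
  rewrite (bigD1 (Ordinal lt_j)) //= eqxx mul1r big1 ?addr0 // => i ne_i.
  by rewrite (_ : (_ == _) = false) ?mul0r //; apply: negbTE.
have GC := universal_add_Q pi0;
  rewrite -(psmap_add2 pi) -(psmap_add2 ptypV_Q) in GC.
rewrite -(psmap_add2 psi) => m lt_m; apply/eqP; rewrite -subr_eq0 -rmorphB.
apply/eqP/(ideal_araki_Q psi0)/piP; rewrite 2!rmorphB; apply/eqP;
  rewrite subr_eq0.
by apply/eqP; apply: GC.
Qed.

End Universal.

(** * The stabilizer coordinates *)

Section LubinTateIdeal.
Variables (p h : nat) (k W : comNzRingType) (red : {rmorphism W -> k}).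
Hypothesis witt : is_witt p red.

Lemma lt_u_coef0 j : lt_u p h W j.+1 0%MM = 0.
Proof. by rewrite /lt_u; case: insubP => [i _ _|_] //=; apply: psX_eq0. Qed.

Lemma coef0M n (A : comNzRingType) (f g : mps n A) : (f * g) 0%MM =
  f 0%MM * g 0%MM.
Proof.
rewrite -[f in LHS](subrK (psC n (f 0%MM))) mulrDl -[LHS]/(pscoef _ _ + pscoef _ _).
rewrite psCM_coef (eqpsM_ord (d := 1) (e := 0)) ?mdeg0 ?add0r //.
by apply/eqps1; rewrite /= eqxx subrr.
Qed.

(** Taking the constant coefficient and reducing to [k] kills p and every u_j, but not 1. *)
Lemma lt_ideal_proper n : ~ ideal_gen n (lt_u p h W) 1.
Proof.
case=> c /(congr1 (fun f : mps h.-1 W => red (f 0%MM))).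
rewrite coef_sum rmorph_sum [LHS]/= eqxx rmorph1 big1 => [/eqP|[[|i] lt_i] _].
- by rewrite oner_eq0.
- rewrite coef0M; apply/(witt_ker witt); exists (c 0%N 0%MM).
  rewrite mulrC; congr (_ * _).
  by rewrite /= -[(p%:R : mps h.-1 W)](rmorph_nat (@psC h.-1 W)) /= eqxx.
by rewrite coef0M lt_u_coef0 mulr0 rmorph0.
Qed.

End LubinTateIdeal.

Lemma comp_inverse_map (A B : comNzRingType) (phi : {rmorphism A -> B}) f g :
  comp_inverse f g -> comp_inverse (psmap phi f) (psmap phi g).
Proof.
case=> f0 g0 fg gf; split; rewrite -?psmap_comp ?fg ?gf ?psmapX //=.
  by rewrite f0 rmorph0.
by rewrite g0 rmorph0.
Qed.

Lemma comp_inverse_comp (A : comNzRingType) (f f' g g' : mps 1 A) :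
  comp_inverse f f' -> comp_inverse g g' ->
  pscomp (pscomp f' g') (pscomp g f) = psX1.
Proof.
case=> f0 f'0 ff' f'f [g0 g'0 gg' g'g].
have gf0 : pscomp g f 0%MM = 0 by rewrite pscomp_coef0.
by rewrite pscompA // -(pscompA g' g0 f0) g'g pscompX.
Qed.

(** [f] is a homomorphism from [F'] to the conjugate of [F] by [g]; composing with [g] cancels [g'].
    This is how h_g maps g_* F to F. *)
Lemma conj_hom (A : comNzRingType) (F F' : mps 2 A) (g g' f : mps 1 A) :
  is_fgl F -> is_fgl F' -> comp_inverse g g' -> f 0%MM = 0 ->
  pscomp f F' = ps2 (pscomp g' (ps2 F (pscomp g (var2 _ 0)) (pscomp g (var2 _ 1))))
     (pscomp f (var2 _ 0)) (pscomp f (var2 _ 1)) ->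
  pscomp (pscomp g f) F' =
  ps2 F (pscomp (pscomp g f) (var2 _ 0)) (pscomp (pscomp g f) (var2 _ 1)).
Proof.
move=> fglF fglF' [g0 g'0 gg' g'g] f0 fH.
have F'0 := fgl_coef0 fglF'.
have v0 i : var2 A i 0%MM = 0 by apply: var2_coef0.
have gv0 i : pscomp g (var2 _ i) 0%MM = 0 by rewrite pscomp_coef0.
have fv0 i : pscomp f (var2 _ i) 0%MM = 0 by rewrite pscomp_coef0.
set e := ps2 F (pscomp g (var2 _ 0)) (pscomp g (var2 _ 1)).
have e0 : e 0%MM = 0 by apply: fgl_add_coef0.
rewrite !pscompA // fH -/e.
rewrite pscomp_ps2 ?pscomp_coef0 // -pscompA // gg' pscompX //.
have fv0' := tnth2_coef0 (fv0 0%N) (fv0 1%N).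
rewrite [LHS]pssubst_ps2 // {1 2}/pscomp !(pssubstA _ _ fv0') //.
by rewrite !(pssubst_var2 (fv0 0%N) (fv0 1%N)).
Qed.

(** [is_fgl_sum] stabilizes each coefficient at an unspecified stage; as the terms of index at least
    [n] have order p^n, stage [n] suffices below that degree. *)
Lemma fgl_sum_trunc (A : comNzRingType) (F : mps 2 A) p (t : nat -> A) s n :
  (1 < p)%N -> is_fgl F -> is_fgl_sum F (fun i => psmon (t i) (p ^ i)) s ->
  s =_[p ^ n] fgl_psum F (fun i => psmon (t i) (p ^ i)) n.
Proof.
move=> p_gt1 fglF sumF m lt_m; have [N sN] := sumF m.
rewrite -(sN (maxn N n)) ?leq_maxl //.
apply: (psum_trunc fglF (d := p ^ n)) lt_m; last exact: leq_maxr.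
  by move=> i; apply: psmon_p_coef0.
by move=> i le_i; apply: (eqpsW (@psmon_ord _ _ _)); rewrite leq_exp2l.
Qed.

(** All data are reduced along [pi] to reach [stabilizer_recursion]. For g_* F only the images of
    v_j with j >= h are computed, since g_* fixes 1 and 0; the lower ones are controlled by
    [pseries_low]. *)
Lemma coord_recursion (p h : nat) (A B : comNzRingType) (G : mps 2 (ptypV p))
    (phi : {rmorphism ptypV p -> A}) (gs : {rmorphism A -> A})
    (pi : {rmorphism A -> B}) (g g' f f' : mps 1 A) (t : nat -> A) :
  let F := psmap phi G in let v := phi \o araki p in
  prime p -> (1 < h)%N -> is_universal_ptypical G ->
  comp_inverse g g' -> comp_inverse f f' ->
  pscomp f (psmap gs F) =
    ps2 (pscomp g' (ps2 F (pscomp g (var2 _ 0)) (pscomp g (var2 _ 1))))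
        (pscomp f (var2 _ 0)) (pscomp f (var2 _ 1)) ->
  is_fgl_sum F (fun i => psmon (t i) (p ^ i)) (pscomp g f) ->
  (forall m, (m < h.-1)%N -> pi (v m) = 0) ->
  v h = 1 -> (forall m, (h < m)%N -> v m = 0) ->
  forall i, (i < h.-1)%N ->
  pi (t i - (t i ^+ (p ^ h) + v h.-1 * t i.+1 ^+ (p ^ h.-1)
    - v h.-1 ^+ (p ^ i.+1) * t i.+1 * t 0%N ^+ (p ^ i.+1 * (p ^ h.-1 - 1)))) =
      0.
Proof.
move=> F v p_pr h_gt1 univG inv_g inv_f fH sum_t v_lo vh v_hi i lt_i.
have p_gt1 := prime_gt1 p_pr.
have [fglG _] := univG; have fglF : is_fgl F by apply: psmap_fgl.
have fglF' : is_fgl (psmap gs F) by apply: psmap_fgl.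
have [f0 f'0 _ _] := inv_f; have [g0 g'0 _ _] := inv_g.
have gfH := conj_hom fglF fglF' inv_g f0 fH.
have f'g := comp_inverse_comp inv_f inv_g.
have F_add : psmap (pi \o phi) G =_[p ^ h.-1] ps_add2 B.
  (* The vanishing of v_1, ..., v_(h-2) gives additivity modulo degree p^(h-1). *)
  have -> : h.-1 = h.-2.+1 by case: (h) h_gt1 => [|[]].
  apply: universal_add => // m lt_m; apply: v_lo.
  by case: (h) h_gt1 lt_m => [|[]].
have sum_tB n : psmap pi (pscomp g f) =_[p ^ n]
    fgl_psum (psmap pi F) (fun j => psmon (pi (t j)) (p ^ j)) n.
  rewrite -(psmap_psum_mon pi F t (expn p)).
  by apply: eqps_map; apply: fgl_sum_trunc.
have pi0 (e : mps 1 A) : e 0%MM = 0 -> psmap pi e 0%MM = 0 by move=> /= ->;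
  rewrite rmorph0.
have gf0 : psmap pi (pscomp g f) 0%MM = 0 by apply: pi0; rewrite pscomp_coef0.
have gf'0 : psmap pi (pscomp f' g') 0%MM = 0 by apply: pi0;
  rewrite pscomp_coef0.
have gf_inv : pscomp (psmap pi (pscomp f' g')) (psmap pi (pscomp g f)) = psX1.
  by rewrite -psmap_comp f'g psmapX.
have gfHB : pscomp (psmap pi (pscomp g f)) (psmap pi (psmap gs F)) =
    ps2 (psmap pi F) (pscomp (psmap pi (pscomp g f)) (var2 B 0))
                     (pscomp (psmap pi (pscomp g f)) (var2 B 1)).
  by rewrite -psmap_comp gfH psmap_ps2 !(psmap_comp pi (pscomp g f)) !psmap_var2.
have vF n := universal_pseries p_pr univG (pi \o phi) (n := n).
(* The reduction of g_* F is again a push-forward of G, so its Araki coefficients are the reductions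
   of the g_*(v_j). *)
have wF n := universal_pseries p_pr univG (pi \o gs \o phi) (n := n).
have pivh : pi (v h) = 1 by rewrite vh rmorph1.
have piv_hi m : (h < m)%N -> pi (v m) = 0 by move=> /v_hi ->; rewrite rmorph0.
have gsvh : pi (gs (v h)) = 1 by rewrite vh !rmorph1.
have gsv_hi m : (h < m)%N -> pi (gs (v m)) = 0.
  by move=> /v_hi ->; rewrite !rmorph0.
have := stabilizer_recursion p_gt1 h_gt1 (psmap_fgl pi fglF)
  (psmap_fgl pi fglF') F_add gf0 gf'0 gf_inv gfHB sum_tB vF wF v_lo pivh piv_hi
  gsvh gsv_hi lt_i.
rewrite !(rmorphB, rmorphD, rmorphM, rmorphXn) /= => <-.
by rewrite exprMn -exprM subn1 [(_ * p ^ i.+1)%N]mulnC mulrCA mulrA addrK subrr.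
Qed.

Theorem theorem4p6 (p h : nat) (hp : prime p) (hh : (2 <= h)%N)
  (* the field with p^h elements and its Witt vectors *)
  (k : finFieldType) (hk : #|k| = (p ^ h)%N)
  (W : comNzRingType) (red : {rmorphism W -> k}) (hW : is_witt p red)
  (* the universal p-typical formal group law and the Honda one *)
  (G : mps 2 (ptypV p)) (hG : is_universal_ptypical G)
  (H : mps 2 'F_p) (hH : is_honda G h H)
  (j : {rmorphism 'F_p -> k})
  (* the universal deformation phi_* G *)
  (phi : {rmorphism ptypV p -> lubin_tate h W}) (hphi : is_lt_phi phi)
  (* g in S_h, and t_i = t_i(g) *)
  (g : mps 1 k) (hg : fgl_iso (psmap j H) (psmap j H) g)
  (t : nat -> lubin_tate h W)
  (ht : is_stabilizer_coord p red (psmap phi G) g t)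
  (i : nat) (hi : (i < h.-1)%N) :
  let u := lt_u p h W h.-1 in
  lt_ideal p h.-1
    (t i - (t i ^+ (p ^ h) + u * t i.+1 ^+ (p ^ h.-1)
            - u ^+ (p ^ i.+1) * t i.+1 * t 0%N ^+ (p ^ i.+1 * (p ^ h.-1 - 1)))).
Proof.
move=> u; have h_gt0 : (0 < h)%N := ltnW hh.
case: ht => ghat [ghat' [gs [f /= [[_ inv_g] _ _ [[[f' inv_f] fH] _] sum_t]]]].
(* [B] is R / I_(h-1), so the goal becomes an equation in [B]. *)
have [B [pi piP]] := ideal_gen_quotient (@lt_ideal_proper p h k W red hW h.-1).
have pi_u m : (m < h.-1)%N -> pi (lt_u p h W m) = 0.
  move=> lt_m; apply/piP; exists (fun l => (l == m)%:R).
  rewrite (bigD1 (Ordinal lt_m)) //= eqxx mul1r big1 ?addr0 // => l ne_l.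
  by rewrite (_ : (_ == _) = false) ?mul0r //; apply: negbTE.
have v_lo m : (m < h.-1)%N -> pi (phi (araki p m)) = 0.
  (* Index 0 is p, preserved by any ring morphism; [is_lt_phi] covers the positive indices. *)
  move=> lt_m; rewrite -(pi_u _ lt_m); case: m lt_m => [|m] lt_m.
    by rewrite rmorph_nat.
  by rewrite hphi // (leq_trans lt_m) // leq_pred.
have vh : phi (araki p h) = 1 by rewrite hphi // ltnn eqxx.
have v_hi m : (h < m)%N -> phi (araki p m) = 0.
  move=> lt_m; rewrite hphi ?(leq_ltn_trans _ lt_m) //.
  by rewrite ltnNge (ltnW lt_m) /= gtn_eqF.
have phi_u : u = phi (araki p h.-1).
  have h1_gt0 : (0 < h.-1)%N by apply: leq_ltn_trans hi.
  by rewrite hphi // ltn_predL h_gt0.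
have inv_gR := comp_inverse_map (@psC h.-1 W) inv_g.
apply/piP; rewrite phi_u.
exact: (coord_recursion hp hh hG inv_gR inv_f fH sum_t v_lo vh v_hi hi).
Qed.
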